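(* Let $\Gamma,H,t,\tau_1,\tau_2,\tau_3,\mathrm T,\mathscr C$ satisfy the standing assumptions in the context, let $z,w:\mathscr C\to\mathbb C$ be non-constant meromorphic with $z(\gamma\mathrm T)=z(\mathrm T)$ and $w(\gamma\mathrm T)=\chi(\gamma)\det(C\mathrm T+D)w(\mathrm T)$ for all $\gamma=\begin{pmatrix}A&B\\ C&D\end{pmatrix}\in\Gamma$ ($\chi$ a character), with $p_1,p_2,p_3$ as in the context, and let $w_0=w$, $w_j=\tau_jw$ ($j=1,2,3$), $w_4=(\tau_1\tau_3-\tau_2^2)w$. Let $g=\exp\bigl\{-2\int^z p_1\,\frac{\mathrm dz}{z}\bigr\}$. Then the four functions $$g\begin{vmatrix}w_0&\theta w_0\\ w_1&\theta w_1\end{vmatrix}^{1/2},\quad g\begin{vmatrix}w_0&\theta w_0\\ w_3&\theta w_3\end{vmatrix}^{1/2},\quad g\begin{vmatrix}w_1&\theta w_1\\ w_4&\theta w_4\end{vmatrix}^{1/2},\quad g\begin{vmatrix}w_3&\theta w_3\\ w_4&\theta w_4\end{vmatrix}^{1/2}$$ satisfy the fourth order linear differential equation \begin{multline*} \theta^4u+16p_1\theta^3u+\tfrac12(187p_1^2+5p_2+38\theta p_1)\theta^2u+\tfrac12\bigl(22\theta^2p_1+5\theta p_2+294p_1\theta p_1+472p_1^3+40p_1p_2\bigr)\theta u\\ +\tfrac1{16}\bigl(-8p_3+9p_2^2+12\theta^2p_2+40\theta^3p_1+160p_1\theta p_2+124p_2\theta p_1+4420p_1^2\theta p_1+680p_1\theta^2p_1+460(\theta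 p_1)^2+622p_1^2p_2+3465p_1^4\bigr)u=0. \end{multline*}
   Context: Standing assumptions: $\Gamma$ is a discrete subgroup of $\mathrm{Sp}_4(\mathbb R)$; $H$ a connected domain in the upper half-plane; $t:H\to\mathbb C$ meromorphic; $\tau_1=\tau$, $\tau_2=-\int_{c_1}^{\tau}t\,\mathrm d\tau$, $\tau_3=\int_{c_2}^{\tau}t^2\,\mathrm d\tau$, $\mathrm T(\tau)=\begin{pmatrix}\tau_1&\tau_2\\ \tau_2&\tau_3\end{pmatrix}$; for each residue $r$ of $t$ the matrix $\begin{pmatrix}1&0&0&2\pi ir\\0&1&2\pi ir&0\\0&0&1&0\\0&0&0&1\end{pmatrix}\in\Gamma$, and for each residue $s$ of $t^2$ the matrix $\begin{pmatrix}1&0&0&0\\0&1&0&2\pi is\\0&0&1&0\\0&0&0&1\end{pmatrix}\in\Gamma$; $\mathscr C=\{\mathrm T(\tau):\tau\in H\}$ with all branches, and $\gamma\mathrm T=(A\mathrm T+B)(C\mathrm T+D)^{-1}$ defines a group action of $\Gamma$ on $\mathscr C$. Notation: $'=\mathrm d/\mathrm d\tau$, $\theta=z\,\mathrm d/\mathrm dz$; $v=\mathrm dt/\mathrm d\tau$, $G_1=z'/z$, $G_2=w'/w$, $G_3=v'/v$; $p_1=\frac{2G_1'-G_1(G_2+G_3)}{2G_1^2}$, $p_2=\frac{24G_3'-20(G_2+G_3)'+5(G_2+G_3)^2-8G_3^2}{20G_1^2}$, $p_3=\frac{-10G_3'''+40G_3G_3''+21(G_3')^2-54G_3^2G_3'+9G_3^4}{50G_1^4}$,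 regarded as functions of $z$. *)

(* Defs.v *)
From Stdlib Require Export Reals List.
From Coquelicot Require Export Coquelicot.
Export ListNotations.
Open Scope C_scope.

(* A meromorphic function takes its values in [option C], the Riemann sphere,
   with [None] for the point at infinity, i.e. for the poles. *)

Definition val {X : Type} (f : X -> option C) (x : X) : C :=
  match f x with Some y => y | None => 0 end.

Definition sqr_mero (f : C -> option C) (x : C) : option C :=
  option_map (fun y => y * y) (f x).

Definition analytic_at (f : C -> C) (a : C) : Prop :=
  exists (c : nat -> C) (r : R), (0 < r)%R /\
    forall x, (Cmod (x - a) < r)%R ->
      @is_pseries C_AbsRing C_NormedModule c (x - a) (f x).

Definition analytic_on (U : C -> Prop) (f : C -> C) : Prop :=
  forall a, U a -> analytic_at f a.

(* f x = sum_n c_n (x - a)^(n - m) on a punctured disc around a. *)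
Definition laurent_at (f : C -> option C) (a : C) (m : nat) (c : nat -> C) : Prop :=
  exists r : R, (0 < r)%R /\
    forall x, x <> a -> (Cmod (x - a) < r)%R ->
      exists y, f x = Some y /\
        @is_pseries C_AbsRing C_NormedModule c (x - a) (y * (x - a) ^ m).

Definition mero_at (f : C -> option C) (a : C) : Prop :=
  exists (m : nat) (c : nat -> C), laurent_at f a m c /\
    ((m = 0%nat /\ f a = Some (c 0%nat)) \/
     ((0 < m)%nat /\ c 0%nat <> 0 /\ f a = None)).

Definition mero_on (U : C -> Prop) (f : C -> option C) : Prop :=
  forall a, U a -> mero_at f a.

(* The coefficient of (x - a)^(-1); [c 0] may vanish here, so a pole order
   bound of the form m + 1 is no restriction. *)
Definition is_residue (f : C -> option C) (a r : C) : Prop :=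
  exists (m : nat) (c : nat -> C), laurent_at f a (S m) c /\ r = c m.

Definition connected_set (U : C -> Prop) : Prop :=
  forall A B : C -> Prop, open A -> open B ->
    (forall x, U x -> A x \/ B x) ->
    (exists x, U x /\ A x) -> (exists x, U x /\ B x) ->
    exists x, U x /\ A x /\ B x.

Definition is_domain (U : C -> Prop) : Prop :=
  (exists x, U x) /\ open U /\ connected_set U.

(* I is one of the values of the integral of f from c to x, along a path in H
   avoiding the poles of f.  Corners of a piecewise C^1 path can be removed by
   a reparametrization, so C^1 paths give all the values. *)
Definition is_integral_value (H : C -> Prop) (f : C -> option C) (c x I : C) : Prop :=
  exists gam dgam : R -> C,
    gam 0%R = c /\ gam 1%R = x /\
    (forall s : R, (0 <= s <= 1)%R ->
       H (gam s) /\ f (gam s) <> None /\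
       @is_derive R_AbsRing C_R_NormedModule gam s (dgam s) /\
       continuous dgam s) /\
    @is_RInt C_R_NormedModule (fun s => val f (gam s) * dgam s) 0 1 I.

Definition M4 := @matrix R 4 4.
Definition M2 := @matrix C 2 2.

Definition transpose4 (g : M4) : M4 :=
  mk_matrix 4 4 (fun i j => coeff_mat 0%R g j i).

Definition J4 : M4 :=
  mk_matrix 4 4 (fun i j =>
    match i, j with
    | 0, 2 | 1, 3 => 1%R
    | 2, 0 | 3, 1 => (-1)%R
    | _, _ => 0%R
    end)%nat.

Definition Sp4 (g : M4) : Prop :=
  Mmult (Mmult (transpose4 g) J4) g = J4.

Definition is_discrete_subgroup_Sp4 (Gam : M4 -> Prop) : Prop :=
  (forall g, Gam g -> Sp4 g) /\
  Gam Mone /\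
  (forall g h, Gam g -> Gam h -> Gam (Mmult g h)) /\
  (forall g, Gam g -> exists h, Gam h /\ Mmult g h = Mone /\ Mmult h g = Mone) /\
  (forall g, Gam g -> exists eps : R, (0 < eps)%R /\
     forall h, Gam h ->
       (forall i j : nat, (i < 4)%nat -> (j < 4)%nat ->
          (Rabs (coeff_mat 0 h i j - coeff_mat 0 g i j) < eps)%R) ->
       h = g).

Definition is_character (Gam : M4 -> Prop) (chi : M4 -> C) : Prop :=
  (forall g, Gam g -> chi g <> 0) /\
  (forall g h, Gam g -> Gam h -> chi (Mmult g h) = chi g * chi h).

(* The 2x2 blocks: (0,0), (0,1), (1,0), (1,1) are A, B, C, D. *)
Definition block (a b : nat) (g : M4) : M2 :=
  mk_matrix 2 2 (fun i j => RtoC (coeff_mat 0%R g (2 * a + i) (2 * b + j))).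

Definition entry (T : M2) (i j : nat) : C := coeff_mat (RtoC 0) T i j.

Definition det2 (T : M2) : C :=
  entry T 0 0 * entry T 1 1 - entry T 0 1 * entry T 1 0.

Definition inv2 (T : M2) : M2 :=
  mk_matrix 2 2 (fun i j =>
    match i, j with
    | O, O => entry T 1 1 / det2 T
    | O, _ => - entry T 0 1 / det2 T
    | _, O => - entry T 1 0 / det2 T
    | _, _ => entry T 0 0 / det2 T
    end).

Definition CTD (g : M4) (T : M2) : M2 :=
  @Mplus C_Ring 2 2 (@Mmult C_Ring 2 2 2 (block 1 0 g) T) (block 1 1 g).

Definition ATB (g : M4) (T : M2) : M2 :=
  @Mplus C_Ring 2 2 (@Mmult C_Ring 2 2 2 (block 0 0 g) T) (block 0 1 g).

Definition act (g : M4) (T : M2) : M2 :=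
  @Mmult C_Ring 2 2 2 (ATB g T) (inv2 (CTD g T)).

Definition is_action_on (Gam : M4 -> Prop) (X : M2 -> Prop) : Prop :=
  (forall g T, Gam g -> X T -> det2 (CTD g T) <> 0 /\ X (act g T)) /\
  (forall T, X T -> act Mone T = T) /\
  (forall g h T, Gam g -> Gam h -> X T -> act (Mmult g h) T = act g (act h T)).

Definition sym2 (x1 x2 x3 : C) : M2 :=
  mk_matrix 2 2 (fun i j =>
    match i, j with
    | 0, 0 => x1
    | 0, 1 | 1, 0 => x2
    | _, _ => x3
    end)%nat.

(* The values of all branches of T at all regular points.  The two integrals
   are continued along independent paths, in accordance with the separate
   conditions on the residues of t and of t^2. *)
Definition curve (H : C -> Prop) (t : C -> option C) (c1 c2 : C) (T : M2) : Prop :=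
  exists tau I2 I3 : C,
    is_integral_value H t c1 tau I2 /\
    is_integral_value H (sqr_mero t) c2 tau I3 /\
    T = sym2 tau (- I2) I3.

(* (tau, tau2 tau, tau3 tau), for tau in U, is a holomorphic branch of T. *)
Definition is_branch (H : C -> Prop) (t : C -> option C) (c1 c2 : C)
    (U : C -> Prop) (tau2 tau3 : C -> C) : Prop :=
  open U /\
  forall tau, U tau ->
    H tau /\ t tau <> None /\
    @is_derive C_AbsRing C_NormedModule tau2 tau (- val t tau) /\
    @is_derive C_AbsRing C_NormedModule tau3 tau (val t tau * val t tau) /\
    curve H t c1 c2 (sym2 tau (tau2 tau) (tau3 tau)).

(* The curve is a Riemann surface with tau as a local coordinate. *)
Definition mero_on_curve (H : C -> Prop) (t : C -> option C) (c1 c2 : C)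
    (f : M2 -> option C) : Prop :=
  forall U tau2 tau3, is_branch H t c1 c2 U tau2 tau3 ->
    mero_on U (fun tau => f (sym2 tau (tau2 tau) (tau3 tau))).

Definition nonconstant_on (X : M2 -> Prop) (f : M2 -> option C) : Prop :=
  ~ exists k, forall T, X T -> f T = k.

Definition residue_matrix_t (x : R) : M4 :=
  mk_matrix 4 4 (fun i j =>
    match i, j with
    | 0, 3 | 1, 2 => x
    | _, _ => if Nat.eqb i j then 1%R else 0%R
    end)%nat.

Definition residue_matrix_t2 (x : R) : M4 :=
  mk_matrix 4 4 (fun i j =>
    match i, j with
    | 1, 3 => x
    | _, _ => if Nat.eqb i j then 1%R else 0%R
    end)%nat.

Record standing_assumptions (Gam : M4 -> Prop) (H : C -> Prop)
    (t : C -> option C) (c1 c2 : C) : Prop := {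
  st_group : is_discrete_subgroup_Sp4 Gam;
  st_domain : is_domain H;
  st_upper : forall tau, H tau -> (0 < Im tau)%R;
  st_mero : mero_on H t;
  st_base1 : H c1 /\ t c1 <> None;
  st_base2 : H c2 /\ t c2 <> None;
  (* Gam consists of real matrices, so 2 pi i r and 2 pi i s are real. *)
  st_residue_t : forall a r, H a -> is_residue t a r ->
    exists x : R, RtoC x = 2 * PI * Ci * r /\ Gam (residue_matrix_t x);
  st_residue_t2 : forall a s, H a -> is_residue (sqr_mero t) a s ->
    exists x : R, RtoC x = 2 * PI * Ci * s /\ Gam (residue_matrix_t2 x);
  st_action : is_action_on Gam (curve H t c1 c2)
}.

Definition logder (f : C -> C) (tau : C) : C := C_derive f tau / f tau.

Definition p1_tau (G1 G2 G3 : C -> C) (tau : C) : C :=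
  (2 * C_derive G1 tau - G1 tau * (G2 tau + G3 tau)) / (2 * G1 tau ^ 2).

Definition p2_tau (G1 G2 G3 : C -> C) (tau : C) : C :=
  (24 * C_derive G3 tau - 20 * C_derive (fun s => G2 s + G3 s) tau
   + 5 * (G2 tau + G3 tau) ^ 2 - 8 * G3 tau ^ 2) / (20 * G1 tau ^ 2).

Definition p3_tau (G1 G3 : C -> C) (tau : C) : C :=
  (- 10 * C_derive (C_derive (C_derive G3)) tau
   + 40 * G3 tau * C_derive (C_derive G3) tau
   + 21 * C_derive G3 tau ^ 2
   - 54 * G3 tau ^ 2 * C_derive G3 tau
   + 9 * G3 tau ^ 4) / (50 * G1 tau ^ 4).

Definition theta (f : C -> C) (x : C) : C := x * C_derive f x.

Definition Cexp (x : C) : C :=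
  RtoC (exp (Re x)) * (RtoC (cos (Im x)) + Ci * RtoC (sin (Im x))).

(* Main.v *)
Require Import Defs.
From Stdlib Require Import Lra.
Open Scope C_scope.

(** Each of the four determinants is a square: it equals [w^2 y^2 / G1], where [y] is [1], [t],
    [tau t + tau2] or [tau3 + tau2 t] respectively.  Since [y' = v q] with [q] one of [0], [1],
    [tau], [tau2], and [q'' = v kappa] with [kappa] constant, [y] is annihilated by
    [D (1/v) D^2 (1/v) D] with [D = d/dtau].  Conjugating this operator by [g w / sqrt G1] and
    passing from [D] to [theta = D / G1] gives the equation; with [L = G1'/G1^2], [B = G2/G1] and
    [K = G3/G1] all the coefficients become polynomials in [L], [B], [K] and their
    [theta]-derivatives, so that only a polynomial identity has to be checked.

    The branch [d] of the square root can be divided by [y] only where [y] does not vanish.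
    There the equation is obtained by computation; it extends to all points by continuity, because
    [y] vanishes identically on no nonempty open set. *)

(** * Complex derivatives *)

(** The four functions [y] are the entries of the row [(t, 1)] times the 2 by 4 matrix [(T | 1)].
    Along the curve the derivative of [T] has the rows [(1, -t)] and [(-t, t^2)]; it has rank one
    and the row [(t, 1)] annihilates it. So only [t] is differentiated in [y], and [q] runs through
    the first row [(tau, tau2, 1, 0)] of [(T | 1)]. Among these only [tau2] has a nonzero second
    derivative, namely [-v], whence [kappa = -1] for the last determinant and [kappa = 0] for the
    others. [C_derive], and with it [theta], is total, so a value of an iterated [theta] means
    nothing until differentiability is known. This is why analytic functions are first shown to be
    differentiable infinitely often, and why [theta] is computed through a relation that includes
    differentiability. *)

Notation is_Cderive f x l :=
  (@is_derive C_AbsRing C_NormedModule f x (l%C : C)) (only parsing).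
Notation is_Cseries a l :=
  (@is_series C_AbsRing C_NormedModule a (l%C : C)) (only parsing).

(** Bridge between two uniform structures on [C]: the neighbourhoods used by [open] and [locally]
    come from the product structure, the estimates from discs for [Cmod]. *)
Lemma locally_Cmod (x : C) (P : C -> Prop) :
  locally x P <-> exists d : R, (0 < d)%R /\ forall y, (Cmod (y - x) < d)%R -> P y.
Proof.
rewrite (locally_C x P). split.
- intros [e He]. exists e. split; [apply cond_pos|exact He].
- intros [d [Hd He]]. exists (mkposreal d Hd). exact He.
Qed.

Lemma is_Cderive_iff (f : C -> C) (x l : C) :
  is_Cderive f x l <-> forall eps : R, (0 < eps)%R ->
  exists d : R, (0 < d)%R /\ forall y, (Cmod (y - x) < d)%R ->
  (Cmod (f y - f x - (y-x) * l) <= eps * Cmod (y-x))%R.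
Proof.
split.
- intros [_ h] e He. specialize (h x (fun P HP => HP) (mkposreal e He)).
  destruct h as [d Hd]. exists d. split; [apply cond_pos|]. intros y Hy. exact (Hd y Hy).
- intros h. split. { apply (@is_linear_scal_l C_AbsRing C_NormedModule l). }
  intros y Hy. assert (E : x = y)
    by exact (is_filter_lim_locally_unique (V:=AbsRing_NormedModule C_AbsRing) x y Hy).
  subst y.
  intros [e He]. destruct (h e He) as [d [Hd H]]. exists (mkposreal d Hd). intros y Hy'.
  exact (H y Hy').
Qed.

(** The two normed module structures on [C] have the same norm, so both notions unfold to the same
    estimate. The product rule and the inner function of the chain rule are stated for
    [AbsRing_NormedModule], the theorem for [C_NormedModule]. *)
Lemma is_Cderive_AbsRing (f : C -> C) (x l : C) :
  is_Cderive f x l <-> @is_derive C_AbsRing (AbsRing_NormedModule C_AbsRing) f x l.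
Proof.
rewrite is_Cderive_iff. split.
- intros h. split. { apply (@is_linear_scal_l C_AbsRing (AbsRing_NormedModule C_AbsRing) l). }
  intros y Hy. assert (E : x = y)
    by exact (is_filter_lim_locally_unique (V:=AbsRing_NormedModule C_AbsRing) x y Hy).
  subst y.
  intros [e He]. destruct (h e He) as [d [Hd H]]. exists (mkposreal d Hd). intros y Hy'.
  exact (H y Hy').
- intros [_ h] e He. specialize (h x (fun P HP => HP) (mkposreal e He)).
  destruct h as [d Hd]. exists d. split; [apply cond_pos|]. intros y Hy. exact (Hd y Hy).
Qed.

Lemma is_Cderive_eq (f : C -> C) (x l l' : C) : is_Cderive f x l -> l = l' -> is_Cderive f x l'.
Proof. intros h <-. exact h. Qed.

Lemma is_Cderive_mult (f g : C -> C) (x a b : C) :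
  is_Cderive f x a -> is_Cderive g x b -> is_Cderive (fun y => f y * g y) x (a * g x + f x * b).
Proof.
rewrite !is_Cderive_AbsRing. intros h1 h2.
exact (is_derive_mult (K:=C_AbsRing) f g x a b h1 h2 Cmult_comm).
Qed.

Lemma is_Cderive_comp (f g : C -> C) (x a b : C) :
  is_Cderive f (g x) a -> is_Cderive g x b -> is_Cderive (fun y => f (g y)) x (b * a).
Proof.
intros h1 h2. apply is_Cderive_AbsRing in h2.
exact (is_derive_comp (K:=C_AbsRing) f g x a b h1 h2).
Qed.

Lemma is_Cderive_plus (f g : C -> C) (x a b : C) :
  is_Cderive f x a -> is_Cderive g x b -> is_Cderive (fun y => f y + g y) x (a + b).
Proof. intros h1 h2. exact (is_derive_plus (K:=C_AbsRing) f g x a b h1 h2). Qed.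

Lemma is_Cderive_const (c x : C) : is_Cderive (fun _ => c) x 0.
Proof. exact (@is_derive_const C_AbsRing C_NormedModule c x). Qed.

Lemma is_Cderive_id (x : C) : is_Cderive (fun y => y) x 1.
Proof. apply is_Cderive_AbsRing. exact (@is_derive_id C_AbsRing x). Qed.

Lemma is_Cderive_ext_loc (f g : C -> C) (x a : C) :
  locally x (fun y => f y = g y) -> is_Cderive f x a -> is_Cderive g x a.
Proof. intros h1 h2. apply (is_derive_ext_loc f); [|exact h2]. apply locally_C, h1. Qed.

Lemma is_Cderive_continuous (f : C -> C) (x a : C) (eps : R) :
  is_Cderive f x a -> (0 < eps)%R -> locally x (fun y => (Cmod (f y - f x) < eps)%R).
Proof.
intros h He. apply locally_Cmod. rewrite is_Cderive_iff in h.
destruct (h 1%R Rlt_0_1) as [d [Hd H]].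
assert (Ha := Cmod_ge_0 a).
set (q := (eps / (2 + Cmod a))%R). assert (Hq : (0 < q)%R) by (apply Rdiv_lt_0_compat; lra).
exists (Rmin d q). split; [apply Rmin_glb_lt; assumption|].
intros y Hy. assert (Hy1 := Rlt_le_trans _ _ _ Hy (Rmin_l _ _)).
assert (Hy2 := Rlt_le_trans _ _ _ Hy (Rmin_r _ _)).
specialize (H y Hy1).
replace (f y - f x) with ((f y - f x - (y-x)*a) + (y-x)*a) by ring.
eapply Rle_lt_trans; [apply Cmod_triangle|]. rewrite Cmod_mult.
apply Rle_lt_trans with (Cmod (y - x) * (1 + Cmod a))%R; [lra|].
apply Rle_lt_trans with (q * (1 + Cmod a))%R.
{ apply Rmult_le_compat_r; lra. }
unfold q. apply Rlt_le_trans with (eps / (2 + Cmod a) * (2 + Cmod a))%R.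
{ apply Rmult_lt_compat_l; [exact Hq|lra]. } right; field; lra.
Qed.

Lemma is_Cderive_nonzero_loc (f : C -> C) (x a : C) :
  is_Cderive f x a -> f x <> 0 -> locally x (fun y => f y <> 0).
Proof.
intros h h0. apply Cmod_gt_0 in h0. generalize (is_Cderive_continuous f x a _ h h0).
apply filter_imp.
intros y Hy E. rewrite E in Hy. replace (0 - f x) with (- f x) in Hy by ring.
rewrite Cmod_opp in Hy. lra.
Qed.

Lemma is_Cderive_Cinv (x : C) : x <> 0 -> is_Cderive Cinv x (- / (x * x)).
Proof.
intros Hx. apply is_Cderive_iff. intros e He.
assert (Hm := proj1 (Cmod_gt_0 x) Hx).
set (m := Cmod x) in *.
(* The error equals [|y - x|^2 / (m^2 |y|)]. The first bound gives [|y| > m/2], and the second then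
   makes the error at most [e |y - x|]. *)
exists (Rmin (m/2) (e * m * m * m / 2))%R.
assert (0 < e * m * m * m / 2)%R by (repeat apply Rmult_lt_0_compat; lra).
split; [apply Rmin_glb_lt; lra|].
intros y Hy. assert (Hy1 := Rlt_le_trans _ _ _ Hy (Rmin_l _ _)).
assert (Hy2 := Rlt_le_trans _ _ _ Hy (Rmin_r _ _)).
assert (Hym : (m / 2 < Cmod y)%R).
{ assert (T := Cmod_triangle (x - y) y). replace (x - y + y) with x in T by ring. fold m in T.
  replace (x - y) with (- (y - x)) in T by ring. rewrite Cmod_opp in T. lra. }
assert (Hy0 : y <> 0). { apply Cmod_gt_0. lra. }
replace (/ y - / x - (y - x) * - / (x * x))
  with ((y - x) * ((y - x) * / (x * x * y))) by (field; auto).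
assert (Hxy : x * x * y <> 0) by (repeat apply Cmult_neq_0; assumption).
rewrite !Cmod_mult, Cmod_inv, !Cmod_mult by assumption. fold m. rewrite Rmult_comm.
apply Rmult_le_compat_r; [apply Cmod_ge_0|].
assert (0 < m * m * Cmod y)%R by (repeat apply Rmult_lt_0_compat; lra).
apply Rmult_le_reg_r with (m * m * Cmod y)%R; [assumption|].
rewrite Rmult_assoc, Rinv_l, Rmult_1_r by lra.
apply Rle_trans with (e * (m * m * (m/2)))%R; [lra|].
apply Rmult_le_compat_l; [lra|]. apply Rmult_le_compat_l; [nra|lra].
Qed.

Lemma is_Cderive_inv (f : C -> C) (x a : C) :
  is_Cderive f x a -> f x <> 0 -> is_Cderive (fun y => / f y) x (- a * (/ f x * / f x)).
Proof.
intros h h0. replace (- a * (/ f x * / f x)) with (a * - / (f x * f x)) by (field; assumption).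
apply (is_Cderive_comp Cinv f); [apply is_Cderive_Cinv|]; assumption.
Qed.

(** * Power series *)

Lemma pow_n_Cpow (x : C) n : @pow_n C_Ring x n = x ^ n.
Proof. induction n as [|n IH]; [reflexivity|]. simpl. rewrite IH. reflexivity. Qed.


Lemma is_pseries_C (c : nat -> C) (x l : C) :
  @is_pseries C_AbsRing C_NormedModule c x l <-> is_Cseries (fun n => c n * x ^ n) l.
Proof.
split; apply is_series_ext; intros n; rewrite Cmult_comm, <- pow_n_Cpow; reflexivity.
Qed.

Lemma Cseries_bounded (a : nat -> C) (l : C) :
  is_Cseries a l -> exists M : R, forall n, (Cmod (a n) <= M)%R.
Proof.
intros h. destruct (filterlim_bounded (sum_n a)) as [M HM]. { exists l. exact h. }
assert (H0 := HM O). assert (0 <= M)%R by exact (Rle_trans _ _ _ (norm_ge_0 _) H0).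
exists (2 * M)%R. intros [|n].
- rewrite sum_O in H0. change (Cmod (a O) <= M)%R in H0. lra.
- assert (H1 := HM n). assert (H2 := HM (S n)). rewrite sum_Sn in H2.
  change (Cmod (sum_n a n) <= M)%R in H1.
  change (Cmod ((sum_n a n : C) + a (S n)) <= M)%R in H2.
  set (s := sum_n a n : C) in *. replace (a (S n)) with ((s + a (S n)) + - s) by ring.
  eapply Rle_trans; [apply Cmod_triangle|]. rewrite Cmod_opp. lra.
Qed.

Lemma Cseries_Cmod_le (a : nat -> C) (b : nat -> R) (l : C) (s : R) :
  is_Cseries a l -> is_series b s -> (forall n, (Cmod (a n) <= b n)%R) -> (Cmod l <= s)%R.
Proof.
intros ha hb hle.
apply (is_lim_seq_le (fun n => @norm C_AbsRing C_NormedModule (sum_n a n)) (sum_n b) (@norm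
  C_AbsRing C_NormedModule l) s).
- intros n. refine (Rle_trans _ _ _ (norm_sum_n_m (V:=C_NormedModule) a 0 n) _).
  apply sum_n_m_le. exact hle.
- apply (filterlim_comp _ _ _ (sum_n a) norm eventually (locally (l : C_NormedModule)));
    [exact ha|apply filterlim_norm].
- exact hb.
Qed.

(* (y + h)^(n+1) - y^(n+1) = y ((y + h)^n - y^n) + h (y + h)^n, so the factor |y| + d is
   gained at each step. *)
Lemma Cpow_incr_le (y h : C) (d : R) n : (0 < d)%R -> (Cmod h <= d)%R ->
  (Cmod ((y + h) ^ n - y ^ n) * d <= Cmod h * (Cmod y + d) ^ n)%R.
Proof.
intros Hd Hh. assert (Hy := Cmod_ge_0 y). assert (Hh0 := Cmod_ge_0 h).
assert (Hp : forall k, (Cmod ((y + h) ^ k) <= (Cmod y + d) ^ k)%R).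
{ intros k. rewrite Cmod_pow. apply pow_incr. split; [apply Cmod_ge_0|].
  eapply Rle_trans; [apply Cmod_triangle|lra]. }
induction n as [|n IH].
- simpl. replace (1 - 1) with (RtoC 0) by ring. rewrite Cmod_0. lra.
- replace ((y + h) ^ S n - y ^ S n)
    with (y * ((y + h) ^ n - y ^ n) + h * (y + h) ^ n) by (simpl; ring).
  assert (T := Cmod_triangle (y * ((y + h) ^ n - y ^ n)) (h * (y + h) ^ n)).
  rewrite !Cmod_mult in T.
  specialize (Hp n). simpl.
  set (A := ((Cmod y + d) ^ n)%R) in *. set (D := Cmod ((y + h) ^ n - y ^ n)) in *.
  set (Q := Cmod ((y + h)^n)) in *.
  apply Rle_trans with ((Cmod y * D + Cmod h * Q) * d)%R. { apply Rmult_le_compat_r; lra. }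
  assert (Cmod y * (D * d) <= Cmod y * (Cmod h * A))%R by (apply Rmult_le_compat_l; lra).
  assert (Cmod h * d * Q <= Cmod h * d * A)%R.
  { apply Rmult_le_compat_l; [apply Rmult_le_pos; lra|lra]. }
  nra.
Qed.

(** The remainder [E_n] satisfies [E_(n+1) = y E_n + h ((y + h)^n - y^n)], so the first order bound
    drives the induction and again a factor [|y| + d] is gained. The bound is of the form constant
    times [(|y| + d)^n], hence summable against the coefficients of a power series. *)
Lemma Cpow_taylor2_le (y h : C) (d : R) n :
  (0 < d)%R -> (Cmod h <= d)%R ->
  (Cmod ((y + h) ^ n - y ^ n - INR n * y ^ pred n * h) * (d * d) <= Cmod h * Cmod h * (Cmod y +
    d) ^ n)%R.
Proof.
intros Hd Hh. assert (Hy := Cmod_ge_0 y). assert (Hh0 := Cmod_ge_0 h).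
induction n as [|n IH].
- simpl. replace (1 - 1 - 0 * 1 * h) with (RtoC 0) by ring. rewrite Cmod_0. nra.
- assert (E : (y + h) ^ S n - y ^ S n - INR (S n) * y ^ pred (S n) * h
     = y * ((y + h) ^ n - y ^ n - INR n * y ^ pred n * h) + h * ((y + h) ^ n - y ^ n)).
  { rewrite S_INR, RtoC_plus. destruct n as [|n]; [simpl; ring|simpl pred; simpl Cpow; ring]. }
  rewrite E. clear E.
  assert (I := Cpow_incr_le y h d n Hd Hh).
  assert (T := Cmod_triangle (y * ((y + h) ^ n - y ^ n - INR n * y ^ pred n * h)) (h * ((y + h)
    ^ n - y ^ n))).
  rewrite !Cmod_mult in T.
  set (A := ((Cmod y + d) ^ n)%R) in *. set (D := Cmod ((y + h) ^ n - y ^ n)) in *.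
  set (Q := Cmod ((y + h) ^ n - y ^ n - INR n * y ^ pred n * h)) in *.
  change ((Cmod y + d) ^ S n)%R with ((Cmod y + d) * A)%R.
  eapply Rle_trans. { apply Rmult_le_compat_r; [nra|exact T]. }
  assert (Cmod y * (Q * (d * d)) <= Cmod y * (Cmod h * Cmod h * A))%R
    by (apply Rmult_le_compat_l; lra).
  assert (Cmod h * d * (D * d) <= Cmod h * d * (Cmod h * A))%R.
  { apply Rmult_le_compat_l; [apply Rmult_le_pos; lra|lra]. }
  nra.
Qed.

Lemma Cpow_der_le (y : C) (d : R) n : (0 < d)%R ->
  (Cmod (INR n * y ^ pred n) * d <= (Cmod y + d) ^ n)%R.
Proof.
intros Hd. assert (Hy := Cmod_ge_0 y).
rewrite Cmod_mult, Cmod_R, Cmod_pow, Rabs_pos_eq by apply pos_INR.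
induction n as [|n IH]; [simpl; lra|].
rewrite S_INR. simpl pred.
change ((Cmod y + d) ^ S n)%R with ((Cmod y + d) * (Cmod y + d) ^ n)%R.
assert (P : (Cmod y ^ n <= (Cmod y + d) ^ n)%R) by (apply pow_incr; lra).
assert (0 <= Cmod y ^ n)%R by (apply pow_le; lra).
assert (Cmod y * (INR n * Cmod y ^ pred n * d) <= Cmod y * (Cmod y + d) ^ n)%R
  by (apply Rmult_le_compat_l; lra).
assert (E : (Cmod y * (INR n * Cmod y ^ pred n * d) = INR n * Cmod y ^ n * d)%R).
{ destruct n; [simpl; ring|simpl pred; simpl pow; ring]. }
assert (d * Cmod y ^ n <= d * (Cmod y + d) ^ n)%R by (apply Rmult_le_compat_l; lra).
nra.
Qed.

Section PowerSeries.
Variables (c : nat -> C) (r : R) (F : C -> C).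
Hypothesis HF : forall y, (Cmod y < r)%R -> is_Cseries (fun n => c n * y ^ n) (F y).

(** Abel's argument: the terms at the midpoint [q] of [rho] and [r] are bounded, so those at [rho]
    are dominated by a geometric series of ratio [rho / q]. *)
Lemma pseries_abs_conv (rho : R) :
  (0 <= rho < r)%R -> ex_series (fun n => Cmod (c n) * rho ^ n)%R.
Proof.
intros [H0 H1]. set (q := ((rho + r) / 2)%R).
assert (Hq : (0 < q < r)%R) by (unfold q; lra).
destruct (Cseries_bounded _ _ (HF (RtoC q) ltac:(rewrite Cmod_R, Rabs_pos_eq; lra))) as [M HM].
apply (ex_series_le (V:=R_CompleteNormedModule) _ (fun n => M * (rho / q) ^ n)%R).
- intros n. change (Rabs (Cmod (c n) * rho ^ n) <= M * (rho / q) ^ n)%R.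
  rewrite Rabs_pos_eq by (apply Rmult_le_pos; [apply Cmod_ge_0|apply pow_le; lra]).
  specialize (HM n). rewrite Cmod_mult, Cmod_pow, Cmod_R, Rabs_pos_eq in HM by lra.
  unfold Rdiv. rewrite Rpow_mult_distr, pow_inv.
  replace (Cmod (c n) * rho ^ n)%R with ((Cmod (c n) * q ^ n) * (rho ^ n * / q ^ n))%R
    by (field; apply pow_nonzero; lra).
  apply Rmult_le_compat_r; [|exact HM].
  apply Rmult_le_pos; [apply pow_le; lra|]. left. apply Rinv_0_lt_compat, pow_lt. lra.
- apply (ex_series_scal_l (V:=R_NormedModule) M). apply ex_series_geom.
  rewrite Rabs_pos_eq.
  + apply Rmult_lt_reg_r with q; [lra|]. unfold Rdiv. rewrite Rmult_assoc, Rinv_l by lra.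
    unfold q; lra.
  + apply Rdiv_le_0_compat; lra.
Qed.

(** Since [|y| + d < r], the one convergent series [b] majorizes the values, the differentiated
    terms up to a factor [1/d], and the second order remainders up to [|h|^2 / d^2]. The error of
    the linear approximation is thus at most [K |h|^2]. *)
Lemma pseries_is_Cderive (y : C) : (Cmod y < r)%R ->
  exists l : C, is_Cseries (fun n => (INR (S n) * c (S n)) * y ^ n) l /\ is_Cderive F y l.
Proof.
intros Hy. assert (Hy0 := Cmod_ge_0 y). set (d := ((r - Cmod y) / 2)%R).
assert (Hd : (0 < d)%R) by (unfold d; lra).
set (b := fun n => (Cmod (c n) * (Cmod y + d) ^ n)%R).
assert (Hb : ex_series b) by (apply pseries_abs_conv; unfold d; lra).
assert (Hl : ex_series (fun n => c n * (INR n * y ^ pred n) : C_CompleteNormedModule)).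
{ apply (ex_series_le (V:=C_CompleteNormedModule) _ (fun n => / d * b n)%R).
  - intros n. change (Cmod (c n * (INR n * y ^ pred n)) <= / d * b n)%R. rewrite Cmod_mult.
    unfold b.
    assert (P := Cpow_der_le y d n Hd). apply Rmult_le_reg_r with d; [exact Hd|].
    replace (/ d * (Cmod (c n) * (Cmod y + d) ^ n) * d)%R
      with (Cmod (c n) * (Cmod y + d) ^ n)%R by (field; lra).
    rewrite Rmult_assoc. apply Rmult_le_compat_l; [apply Cmod_ge_0|exact P].
  - apply (ex_series_scal_l (V:=R_NormedModule) (/ d)%R). exact Hb. }
destruct Hl as [l Hl]. exists l. split.
(* The term at [n = 0] vanishes because of the factor [INR 0], whatever [y ^ pred 0] is, so the
   shift of the index leaves the sum [l] unchanged. *)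
{ assert (I := is_series_incr_1 (V:=C_NormedModule) (fun n => c n * (INR n * y ^ pred n)) l).
  refine (is_series_ext _ _ _ _ (I _)).
  - intros n. simpl pred. change (c (S n) * (INR (S n) * y ^ n) = INR (S n) * c (S n) * y ^ n).
    ring.
  - replace (plus l _) with l; [exact Hl|].
    simpl INR. change (@eq C l ((l:C) + c O * (0 * 1))).
    rewrite Cmult_0_l, Cmult_0_r, Cplus_0_r. reflexivity. }
destruct Hb as [s Hs].
assert (Hs0 : (0 <= s)%R).
{ eapply Rle_trans; [apply Cmod_ge_0|]. apply (Cseries_Cmod_le _ _ _ _ (HF y Hy) Hs). intros n.
  rewrite Cmod_mult, Cmod_pow. unfold b. apply Rmult_le_compat_l; [apply Cmod_ge_0|].
  apply pow_incr; lra. }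
apply is_Cderive_iff. intros e He.
set (K := (s / (d * d))%R). assert (HK : (0 <= K)%R) by (apply Rdiv_le_0_compat; nra).
exists (Rmin d (e / (K + 1)))%R.
assert (0 < e / (K + 1))%R by (apply Rdiv_lt_0_compat; lra).
split; [apply Rmin_glb_lt; lra|]. intros x Hx.
assert (Hx1 := Rlt_le_trans _ _ _ Hx (Rmin_l _ _)).
assert (Hx2 := Rlt_le_trans _ _ _ Hx (Rmin_r _ _)).
set (h := x - y) in *. assert (Ex : x = y + h) by (unfold h; ring).
assert (Hxr : (Cmod x < r)%R).
{ rewrite Ex. eapply Rle_lt_trans; [apply Cmod_triangle|]. unfold d in Hx1; lra. }
assert (HS : is_Cseries (fun n =>
  c n * ((y + h) ^ n - y ^ n - INR n * y ^ pred n * h)) (F x - F y - h * l)).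
{ assert (S1 := is_series_minus _ _ _ _ (HF x Hxr) (HF y Hy)).
  assert (S2 := is_series_minus _ _ _ _ S1 (is_series_scal (h : C_AbsRing) _ _ Hl)).
  revert S2. apply is_series_ext. intros n.
  change (c n * x ^ n - c n * y ^ n - h * (c n * (INR n * y ^ pred n))
    = c n * ((y + h) ^ n - y ^ n - INR n * y ^ pred n * h)).
  rewrite Ex. ring. }
set (kk := (Cmod h * Cmod h / (d * d))%R).
assert (B := Cseries_Cmod_le _ (fun n =>
  kk * b n)%R _ (kk * s)%R HS (is_series_scal (V:=R_NormedModule) kk _ _ Hs)).
eapply Rle_trans; [apply B|].
- intros n. rewrite Cmod_mult. unfold b, kk.
  assert (P := Cpow_taylor2_le y h d n Hd ltac:(lra)).
  apply Rmult_le_reg_r with (d * d)%R; [nra|].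
  replace (Cmod h * Cmod h / (d * d) * (Cmod (c n) * (Cmod y + d) ^ n) * (d * d))%R
    with (Cmod (c n) * (Cmod h * Cmod h * (Cmod y + d) ^ n))%R by (field; lra).
  rewrite Rmult_assoc. apply Rmult_le_compat_l; [apply Cmod_ge_0|exact P].
- unfold kk.
  replace (Cmod h * Cmod h / (d * d) * s)%R
    with (Cmod h * (Cmod h * K))%R by (unfold K; field; lra).
  rewrite (Rmult_comm e). apply Rmult_le_compat_l; [apply Cmod_ge_0|].
  apply Rle_trans with (e / (K + 1) * (K + 1))%R; [|right; field; lra].
  apply Rmult_le_compat; try lra. apply Cmod_ge_0.
Qed.
End PowerSeries.

(** Termwise differentiation holds at every point of the disc, while the derived series stays
    centred at [a]. So no re-expansion is involved, and the conclusion can be iterated. *)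
Lemma analytic_at_is_Cderive (f : C -> C) (a : C) : analytic_at f a ->
  is_Cderive f a (C_derive f a) /\ analytic_at (C_derive f) a.
Proof.
intros [c [r [Hr Hf]]].
set (F := fun y => f (y + a)).
assert (HF : forall y, (Cmod y < r)%R -> is_Cseries (fun n => c n * y ^ n) (F y)).
{ intros y Hy. apply is_pseries_C. unfold F. replace y with (y + a - a) at 1 by ring. apply Hf.
  replace (y + a - a) with y by ring. exact Hy. }
assert (D : forall x, (Cmod (x - a) < r)%R -> exists l : C,
  is_Cseries (fun n => (INR (S n) * c (S n)) * (x - a) ^ n) l /\ is_Cderive f x l).
{ intros x Hx. destruct (pseries_is_Cderive c r F HF (x - a) Hx) as [l [H1 H2]]. exists l.
  split; [exact H1|].
  apply (is_Cderive_ext_loc (fun x => F (x - a))).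
  { apply filter_forall. intros y. unfold F. f_equal. ring. }
  replace l with (1 * l) by ring. apply (is_Cderive_comp F (fun x => x - a)); [exact H2|].
  replace (RtoC 1) with (1 + 0) by ring.
  apply (is_Cderive_plus (fun y => y) (fun _ => - a));
    [apply is_Cderive_id|apply is_Cderive_const].
  }
split.
- destruct (D a) as [l [_ H]].
  { replace (a - a) with (RtoC 0) by ring. rewrite Cmod_0. exact Hr. }
  rewrite (is_C_derive_unique _ _ _ H). exact H.
- exists (fun n => INR (S n) * c (S n)), r. split; [exact Hr|]. intros x Hx. apply is_pseries_C.
  destruct (D x Hx) as [l [H1 H2]]. rewrite (is_C_derive_unique _ _ _ H2). exact H1.
Qed.

(** * The exponential function *)

Lemma Cexp_plus (x y : C) : Cexp (x + y) = Cexp x * Cexp y.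
Proof.
destruct x as [x1 x2], y as [y1 y2]. unfold Cexp, Cplus, Cmult, RtoC, Ci, Re, Im; simpl.
rewrite exp_plus, cos_plus, sin_plus. apply injective_projections; simpl; ring.
Qed.

Lemma derivable_pt_lim_0_le (f : R -> R) (l e : R) :
  derivable_pt_lim f 0 l -> (0 < e)%R -> exists d : R, (0 < d)%R /\ forall h, (Rabs h < d)%R ->
  (Rabs (f h - f 0 - h * l) <= e * Rabs h)%R.
Proof.
intros H He. destruct (H e He) as [d Hd]. exists d. split; [apply cond_pos|]. intros h Hh.
destruct (Req_dec h 0) as [->|h0].
- replace (f 0 - f 0 - 0 * l)%R with 0%R by ring. rewrite Rabs_R0. lra.
- specialize (Hd h h0 Hh). rewrite Rplus_0_l in Hd.
  replace (f h - f 0 - h * l)%R with (((f h - f 0) / h - l) * h)%R by (field; exact h0).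
  rewrite Rabs_mult. apply Rmult_le_compat_r; [apply Rabs_pos|lra].
Qed.

Lemma is_Cderive_Cexp_0 : is_Cderive Cexp (RtoC 0) 1.
Proof.
apply is_Cderive_iff. intros e He.
(* The error is split below into four terms, bounded by [e' m], [2 e' m], [2 e' m] and [e' m], which
   accounts for the 6. The minimum with 1 keeps [exp h1] below 2. *)
set (e' := (Rmin e 1 / 6)%R). assert (He' : (0 < e' <= 1/6)%R).
{ unfold e'. assert (M := Rmin_r e 1). assert (0 < Rmin e 1)%R by (apply Rmin_glb_lt; lra).
  lra. }
assert (He2 : (6 * e' <= e)%R) by (unfold e'; assert (M := Rmin_l e 1); lra).
destruct (derivable_pt_lim_0_le exp 1 e' derivable_pt_lim_exp_0 (proj1 He')) as [d1 [Hd1 D1]].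
destruct (derivable_pt_lim_0_le cos (-0)%R e') as [d2 [Hd2 D2]];
  [generalize (derivable_pt_lim_cos 0); rewrite sin_0; trivial|lra|].
destruct (derivable_pt_lim_0_le sin 1 e') as [d3 [Hd3 D3]];
  [generalize (derivable_pt_lim_sin 0); rewrite cos_0; trivial|lra|].
rewrite exp_0 in D1. rewrite cos_0 in D2. rewrite sin_0 in D3.
exists (Rmin (Rmin d1 d2) (Rmin d3 (e'/2)))%R.
split; [repeat apply Rmin_glb_lt; lra|].
intros h Hh. replace (h - 0) with h in * by ring.
assert (Rmin d1 d2 <= d1 /\ Rmin d1 d2 <= d2)%R by (split; [apply Rmin_l|apply Rmin_r]).
assert (Rmin d3 (e'/2) <= d3 /\ Rmin d3 (e'/2) <= e'/2)%R
  by (split; [apply Rmin_l|apply Rmin_r]).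
assert (Hh1 := Rlt_le_trans _ _ _ Hh (Rmin_l _ _)).
assert (Hh2 := Rlt_le_trans _ _ _ Hh (Rmin_r _ _)).
destruct h as [h1 h2]. assert (Hm := Rmax_Cmod (h1,h2)). simpl in Hm.
assert (M1 := Rmax_l (Rabs h1) (Rabs h2)). assert (M2 := Rmax_r (Rabs h1) (Rabs h2)).
set (m := Cmod (h1,h2)) in *.
specialize (D1 h1 ltac:(lra)). specialize (D2 h2 ltac:(lra)). specialize (D3 h2 ltac:(lra)).
set (E := exp h1) in *.
assert (E1 : (Rabs (E - 1) <= e')%R).
{ replace (E - 1)%R with ((E - 1 - h1 * 1) + h1)%R by ring.
  eapply Rle_trans; [apply Rabs_triang|].
  assert (e' * Rabs h1 <= 1 * Rabs h1)%R by (apply Rmult_le_compat_r; [apply Rabs_pos|lra]).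
  lra. }
assert (EA : (Rabs E <= 2)%R).
{ replace E with ((E - 1) + 1)%R by ring. eapply Rle_trans; [apply Rabs_triang|].
rewrite Rabs_R1. lra. }
replace (Cexp (h1,h2) - Cexp 0 - (h1,h2) * 1) with
  (RtoC (E - 1 - h1 * 1) + RtoC (E * (cos h2 - 1 - h2 * -0)) + Ci * RtoC (E * (sin h2 - 0 - h2
    * 1)) + Ci * RtoC ((E - 1) * h2)).
2:{ unfold Cexp, Cplus, Cminus, Copp, Cmult, RtoC, Ci, Re, Im; simpl.
  fold E. rewrite exp_0, cos_0, sin_0.
    apply injective_projections; simpl; ring. }
assert (Hm0 : (0 <= m)%R) by apply Cmod_ge_0.
assert (e' * Rabs h1 <= e' * m /\
  e' * Rabs h2 <= e' * m)%R by (split; apply Rmult_le_compat_l; lra).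
eapply Rle_trans; [apply Cmod_triangle|].
eapply Rle_trans; [apply Rplus_le_compat_r, Cmod_triangle|].
eapply Rle_trans; [apply Rplus_le_compat_r, Rplus_le_compat_r, Cmod_triangle|].
rewrite !Cmod_mult, Cmod_Ci, !Cmod_R, !Rabs_mult.
assert (Rabs E * Rabs (cos h2 - 1 - h2 * -0) <= 2 * (e' * m))%R
  by (apply Rmult_le_compat; try apply Rabs_pos; lra).
assert (Rabs E * Rabs (sin h2 - 0 - h2 * 1) <= 2 * (e' * m))%R
  by (apply Rmult_le_compat; try apply Rabs_pos; lra).
assert (Rabs (E - 1) * Rabs h2 <= e' * m)%R by (apply Rmult_le_compat; try apply Rabs_pos; lra).
apply Rle_trans with (6 * e' * m)%R; [lra|]. apply Rmult_le_compat_r; lra.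
Qed.

Lemma is_Cderive_Cexp (a : C) : is_Cderive Cexp a (Cexp a).
Proof.
apply (is_Cderive_ext_loc (fun x => Cexp a * Cexp (x + - a))).
{ apply filter_forall. intros x. rewrite <- Cexp_plus. f_equal. ring. }
apply (is_Cderive_eq _ _ (0 * Cexp (a + - a) + Cexp a * ((1 + 0) * 1))); [|ring].
apply (is_Cderive_mult (fun _ => Cexp a) (fun x => Cexp (x + - a))); [apply is_Cderive_const|].
apply (is_Cderive_comp Cexp (fun x => x + - a)).
- replace (a + - a) with (RtoC 0) by ring. apply is_Cderive_Cexp_0.
- apply (is_Cderive_plus (fun y => y) (fun _ => - a));
    [apply is_Cderive_id|apply is_Cderive_const].
Qed.

(** * Infinitely differentiable functions *)

(** The derivative is an existential witness and matters only on [V], so each closure rule can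
    supply the formula that the differentiation rules give; passing to [C_derive] is a separate
    step. *)
Fixpoint n_times_derivable (V : C -> Prop) (n : nat) (f : C -> C) : Prop :=
  match n with
  | O => True
  | S n => exists f' : C -> C, (forall x, V x -> is_Cderive f x (f' x)) /\
    n_times_derivable V n f'
  end.

Definition smooth (V : C -> Prop) (f : C -> C) : Prop := forall n, n_times_derivable V n f.

Section Smooth.
Variable V : C -> Prop.
Hypothesis HV : open V.

Lemma is_Cderive_ext_on (f g : C -> C) (x l : C) :
  (forall y, V y -> f y = g y) -> V x -> is_Cderive f x l -> is_Cderive g x l.
Proof. intros E Hx. apply is_Cderive_ext_loc. exact (filter_imp V _ E (HV x Hx)). Qed.

Lemma n_times_derivable_ext n (f g : C -> C) :
  (forall y, V y -> f y = g y) -> n_times_derivable V n f -> n_times_derivable V n g.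
Proof.
destruct n as [|n]; [trivial|]. intros E [f' [H1 H2]]. exists f'. split; [|exact H2].
intros x Hx. apply (is_Cderive_ext_on f); auto.
Qed.

Lemma smooth_ext (f g : C -> C) : (forall y, V y -> f y = g y) -> smooth V f -> smooth V g.
Proof. intros E H n. exact (n_times_derivable_ext n f g E (H n)). Qed.

Lemma smooth_is_Cderive (f : C -> C) (x : C) :
  smooth V f -> V x -> is_Cderive f x (C_derive f x).
Proof.
intros H Hx. destruct (H 1%nat) as [f' [H1 _]]. specialize (H1 x Hx).
rewrite (is_C_derive_unique _ _ _ H1). exact H1.
Qed.

Lemma smooth_C_derive (f : C -> C) : smooth V f -> smooth V (C_derive f).
Proof.
intros H n. destruct (H (S n)) as [f' [H1 H2]]. apply (n_times_derivable_ext n f'); [|exact H2].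
intros y Hy. symmetry. apply is_C_derive_unique. auto.
Qed.

Lemma n_times_derivable_le n (f : C -> C) :
  n_times_derivable V (S n) f -> n_times_derivable V n f.
Proof.
revert f. induction n as [|n IH]; intros f H; [exact I|]. destruct H as [f' [H1 H2]].
exists f'. split; [exact H1|]. apply IH, H2.
Qed.

Lemma n_times_derivable_const n (c : C) : n_times_derivable V n (fun _ => c).
Proof.
revert c. induction n as [|n IH]; intros c; [exact I|]. exists (fun _ => RtoC 0).
split; [|apply IH].
intros x _. apply is_Cderive_const.
Qed.

Lemma n_times_derivable_plus n (f g : C -> C) :
  n_times_derivable V n f -> n_times_derivable V n g ->
  n_times_derivable V n (fun x => f x + g x).
Proof.
revert f g. induction n as [|n IH]; intros f g; [trivial|]. intros [f' [F1 F2]] [g' [G1 G2]].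
exists (fun x => f' x + g' x). split; [|apply IH; assumption]. intros x Hx.
apply is_Cderive_plus; auto.
Qed.

Lemma n_times_derivable_mult n (f g : C -> C) :
  n_times_derivable V n f -> n_times_derivable V n g ->
  n_times_derivable V n (fun x => f x * g x).
Proof.
revert f g. induction n as [|n IH]; intros f g; [trivial|]. intros Hf Hg.
assert (Hf0 := n_times_derivable_le n f Hf). assert (Hg0 := n_times_derivable_le n g Hg).
destruct Hf as [f' [F1 F2]], Hg as [g' [G1 G2]].
exists (fun x => f' x * g x + f x * g' x). split.
- intros x Hx. apply is_Cderive_mult; auto.
- apply n_times_derivable_plus; apply IH; assumption.
Qed.

Lemma n_times_derivable_inv n (f : C -> C) :
  (forall x, V x -> f x <> 0) -> n_times_derivable V n f ->
  n_times_derivable V n (fun x => / f x).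
Proof.
intros H0. induction n as [|n IH]; [trivial|]. intros Hf.
assert (Hf0 := n_times_derivable_le n f Hf).
destruct Hf as [f' [F1 F2]]. exists (fun x => - f' x * (/ f x * / f x)). split.
- intros x Hx. apply is_Cderive_inv; auto.
- apply n_times_derivable_mult; [|apply n_times_derivable_mult; apply IH; assumption].
  apply (n_times_derivable_ext n (fun x => (-1) * f' x)); [intros; ring|].
  apply n_times_derivable_mult; [apply n_times_derivable_const|assumption].
Qed.

Lemma smooth_const (c : C) : smooth V (fun _ => c).
Proof. intros n. apply n_times_derivable_const. Qed.

Lemma smooth_id : smooth V (fun x => x).
Proof.
intros [|n]; [exact I|]. exists (fun _ => RtoC 1). split; [|apply n_times_derivable_const].
intros; apply is_Cderive_id.
Qed.

Lemma smooth_plus (f g : C -> C) : smooth V f -> smooth V g -> smooth V (fun x => f x + g x).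
Proof. intros F G n. apply n_times_derivable_plus; auto. Qed.

Lemma smooth_mult (f g : C -> C) : smooth V f -> smooth V g -> smooth V (fun x => f x * g x).
Proof. intros F G n. apply n_times_derivable_mult; auto. Qed.

Lemma smooth_inv (f : C -> C) :
  (forall x, V x -> f x <> 0) -> smooth V f -> smooth V (fun x => / f x).
Proof. intros H0 F n. apply n_times_derivable_inv; auto. Qed.

Lemma smooth_div (f g : C -> C) :
  (forall x, V x -> g x <> 0) -> smooth V f -> smooth V g -> smooth V (fun x => f x / g x).
Proof.
intros H0 F G. apply (smooth_mult f (fun x => / g x)); [|apply smooth_inv]; assumption.
Qed.

Lemma smooth_opp (f : C -> C) : smooth V f -> smooth V (fun x => - f x).
Proof.
intros F. apply (smooth_ext (fun x => (-1) * f x)); [intros; ring|].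
apply smooth_mult; [apply smooth_const|exact F].
Qed.

Lemma smooth_minus (f g : C -> C) : smooth V f -> smooth V g -> smooth V (fun x => f x - g x).
Proof. intros F G. apply (smooth_plus f (fun x => - g x)); [|apply smooth_opp]; assumption. Qed.

Lemma smooth_pow (f : C -> C) k : smooth V f -> smooth V (fun x => f x ^ k).
Proof.
intros F. induction k as [|k IH]; [apply (smooth_const 1)|].
apply (smooth_mult f (fun x => f x ^ k)); assumption.
Qed.

Lemma smooth_analytic (f : C -> C) : analytic_on V f -> smooth V f.
Proof.
intros H n. revert f H. induction n as [|n IH]; intros f H; [exact I|].
exists (C_derive f). split.
- intros x Hx. apply analytic_at_is_Cderive, H, Hx.
- apply IH. intros x Hx. apply analytic_at_is_Cderive, H, Hx.
Qed.

Lemma smooth_theta (f : C -> C) : smooth V f -> smooth V (theta f).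
Proof.
intros H.
apply (smooth_mult (fun x => x) (C_derive f)); [apply smooth_id|apply smooth_C_derive, H].
Qed.
End Smooth.

Lemma n_times_derivable_comp (V W : C -> Prop) n (f g : C -> C) :
  (forall x, V x -> W (g x)) -> n_times_derivable W n f -> n_times_derivable V n g ->
  n_times_derivable V n (fun x => f (g x)).
Proof.
intros HW. revert f. induction n as [|n IH]; intros f; [trivial|]. intros Hf Hg.
assert (Hg0 := n_times_derivable_le V n g Hg). destruct Hf as [f' [F1 F2]], Hg as [g' [G1 G2]].
exists (fun x => g' x * f' (g x)). split.
- intros x Hx. apply is_Cderive_comp; auto.
- apply n_times_derivable_mult; [assumption|]. apply IH; assumption.
Qed.

Lemma smooth_comp (V W : C -> Prop) (f g : C -> C) : (forall x, V x -> W (g x)) ->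
  smooth W f -> smooth V g -> smooth V (fun x => f (g x)).
Proof. intros HW F G n. apply (n_times_derivable_comp V W); auto. Qed.

Lemma smooth_sub (V W : C -> Prop) (f : C -> C) :
  (forall x, W x -> V x) -> smooth V f -> smooth W f.
Proof.
intros H F. apply (smooth_comp W V f (fun x => x)); [exact H|exact F|apply smooth_id].
Qed.

Lemma smooth_Cexp (V : C -> Prop) : smooth V Cexp.
Proof.
intros n. induction n as [|n IH]; [exact I|]. exists Cexp. split; [|exact IH].
intros; apply is_Cderive_Cexp.
Qed.

Lemma smooth_primitive (V : C -> Prop) (f f' : C -> C) :
  (forall x, V x -> is_Cderive f x (f' x)) -> smooth V f' -> smooth V f.
Proof. intros H F [|n]; [exact I|]. exists f'. split; [exact H|apply F]. Qed.

(** * The derivation theta *)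

(** Stronger than the equation [theta f x = f' x], which would also hold for a junk value of
    [C_derive]: differentiability is part of the relation. *)
Definition is_theta (Z : C -> Prop) (f f' : C -> C) :
  Prop := forall x, Z x -> is_Cderive f x (f' x / x).

Section ThetaRules.
Variable Z : C -> Prop.
Hypothesis HZ : open Z.
Hypothesis HZ0 : forall x, Z x -> x <> 0.

Lemma smooth_is_theta (f : C -> C) : smooth Z f -> is_theta Z f (theta f).
Proof.
intros H x Hx.
apply (is_Cderive_eq _ _ (C_derive f x)); [apply (smooth_is_Cderive Z); assumption|].
unfold theta. field. auto.
Qed.

Lemma is_theta_unique (f f' : C -> C) (x : C) : is_theta Z f f' -> Z x -> theta f x = f' x.
Proof.
intros H Hx. unfold theta. rewrite (is_C_derive_unique _ _ _ (H x Hx)). field. auto.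
Qed.

Lemma is_theta_ext (f f' g g' : C -> C) :
  (forall x, Z x -> f x = g x) -> (forall x, Z x -> f' x = g' x) -> is_theta Z f f' ->
  is_theta Z g g'.
Proof.
intros E E' H x Hx. rewrite <- E' by exact Hx. apply (is_Cderive_ext_on Z HZ f); auto.
Qed.

Lemma is_theta_ext_l (f g g' : C -> C) :
  (forall x, Z x -> f x = g x) -> is_theta Z g g' -> is_theta Z f g'.
Proof. intros E. apply is_theta_ext; [|reflexivity]. intros x Hx. symmetry. auto. Qed.

Lemma theta_ext_on (f g : C -> C) (x : C) :
  (forall x, Z x -> f x = g x) -> smooth Z g -> Z x -> theta f x = theta g x.
Proof.
intros E sg. apply is_theta_unique. exact (is_theta_ext_l f g _ E (smooth_is_theta g sg)).
Qed.

(** Makes iteration possible: [theta f] is replaced by the explicit expression [f'], with which it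
    agrees on the open set [Z]. *)
Lemma is_theta_step (f f' f'' : C -> C) :
  is_theta Z f f' -> is_theta Z f' f'' -> is_theta Z (theta f) f''.
Proof.
intros H H'. apply (is_theta_ext f' f''); auto. intros x Hx. symmetry.
apply is_theta_unique; assumption.
Qed.

Lemma is_theta_const (c : C) : is_theta Z (fun _ => c) (fun _ => RtoC 0).
Proof. intros x Hx. apply (is_Cderive_eq _ _ 0); [apply is_Cderive_const|]. field. auto. Qed.

Lemma is_theta_plus (f f' g g' : C -> C) :
  is_theta Z f f' -> is_theta Z g g' -> is_theta Z (fun x => f x + g x) (fun x => f' x + g' x).
Proof.
intros F G x Hx.
apply (is_Cderive_eq _ _ (f' x / x + g' x / x)); [apply is_Cderive_plus; auto|]. field; auto.
Qed.

Lemma is_theta_mult (f f' g g' : C -> C) :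
  is_theta Z f f' -> is_theta Z g g' ->
  is_theta Z (fun x => f x * g x) (fun x => f' x * g x + f x * g' x).
Proof.
intros F G x Hx.
apply (is_Cderive_eq _ _ (f' x / x * g x + f x * (g' x / x))); [apply is_Cderive_mult; auto|].
field; auto.
Qed.

Lemma is_theta_opp (f f' : C -> C) :
  is_theta Z f f' -> is_theta Z (fun x => - f x) (fun x => - f' x).
Proof.
intros F.
apply (is_theta_ext (fun x => (-1) * f x) (fun x => 0 * f x + (-1) * f' x)); [intros;
  ring|intros; ring|].
apply (is_theta_mult (fun _ => -1) _ f); [apply is_theta_const|exact F].
Qed.

Lemma is_theta_minus (f f' g g' : C -> C) :
  is_theta Z f f' -> is_theta Z g g' -> is_theta Z (fun x => f x - g x) (fun x => f' x - g' x).
Proof.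
intros F G. apply (is_theta_plus f _ (fun x => - g x)); [|apply is_theta_opp]; assumption.
Qed.

Lemma is_theta_inv (f f' : C -> C) :
  (forall x, Z x -> f x <> 0) -> is_theta Z f f' ->
  is_theta Z (fun x => / f x) (fun x => - f' x / (f x * f x)).
Proof.
intros H0 F x Hx.
apply (is_Cderive_eq _ _ (- (f' x / x) * (/ f x * / f x))); [apply is_Cderive_inv; auto|].
field; auto.
Qed.

Lemma is_theta_sqr (f f' : C -> C) :
  is_theta Z f f' -> is_theta Z (fun x => f x ^ 2) (fun x => 2 * f x * f' x).
Proof.
intros F.
apply (is_theta_ext (fun x => f x * f x) (fun x => f' x * f x + f x * f' x)); [intros;
  ring|intros; ring|].
apply is_theta_mult; assumption.
Qed.
End ThetaRules.

(** Usually called with an evar for the derivative, which is built by recursion on the expression;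
    the [is_theta] hypotheses in the context serve as the table of derivatives of the atoms. *)
Ltac is_theta_auto HZ HZ0 :=
  cbv beta;
  lazymatch goal with
  | |- is_theta _ (fun _ => ?c) _ => exact (is_theta_const _ HZ0 c)
  | |- is_theta _ (fun x => _ + _) _ => refine (is_theta_plus _ HZ0 _ _ _ _ _ _);
    is_theta_auto HZ HZ0
  | |- is_theta _ (fun x => _ - _) _ => refine (is_theta_minus _ HZ HZ0 _ _ _ _ _ _);
    is_theta_auto HZ HZ0
  | |- is_theta _ (fun x => _ * _) _ => refine (is_theta_mult _ HZ0 _ _ _ _ _ _);
    is_theta_auto HZ HZ0
  | |- is_theta _ (fun x => _ ^ 2) _ => refine (is_theta_sqr _ HZ HZ0 _ _ _);
    is_theta_auto HZ HZ0
  | |- is_theta _ (fun x => - _) _ => refine (is_theta_opp _ HZ HZ0 _ _ _); is_theta_auto HZ HZ0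
  | H : is_theta _ ?f _ |- is_theta _ (fun x => ?f x) _ => exact H
  | H : is_theta _ ?f _ |- is_theta _ ?f _ => exact H
  end.

Lemma RtoC_neq_0 (x : R) : x <> 0%R -> RtoC x <> 0.
Proof. intros H E. apply H, RtoC_inj, E. Qed.

Ltac neq_0 := repeat split; first [assumption | apply RtoC_neq_0; lra].

(** * The differential equation *)

Definition ode_lhs (p1 p2 p3 u : C -> C) (x : C) : C :=
  theta (theta (theta (theta u))) x
  + 16 * p1 x * theta (theta (theta u)) x
  + 1 / 2 * (187 * p1 x ^ 2 + 5 * p2 x + 38 * theta p1 x) * theta (theta u) x
  + 1 / 2 * (22 * theta (theta p1) x + 5 * theta p2 x + 294 * p1 x * theta p1 x
             + 472 * p1 x ^ 3 + 40 * p1 x * p2 x) * theta u x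
  + 1 / 16 * (- 8 * p3 x + 9 * p2 x ^ 2 + 12 * theta (theta p2) x
              + 40 * theta (theta (theta p1)) x + 160 * p1 x * theta p2 x
              + 124 * p2 x * theta p1 x + 4420 * p1 x ^ 2 * theta p1 x
              + 680 * p1 x * theta (theta p1) x + 460 * theta p1 x ^ 2
              + 622 * p1 x ^ 2 * p2 x + 3465 * p1 x ^ 4) * u x.

(** The system makes every iterated [theta] of [u] a linear combination of [u], [Y1], [Y2], [Y3]
    with polynomial coefficients. For [m = g w / sqrt G1] the logarithmic derivative is
    [-2 p1 + B - L/2 = 2 B + K - 5/2 L]; in the later rows each new factor [v] adds [K] and each new
    factor [1/G1] subtracts [L]. [K1], [K2], [K3] are the derivatives of [G3] of order 1, 2, 3
    divided by the powers 2, 3, 4 of [G1]. *)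
Lemma ode_of_triangular_system (Z : C -> Prop) (L B K p1 p2 p3 Y1 Y2 Y3 u : C -> C) :
  open Z -> (forall x, Z x -> x <> 0) ->
  smooth Z L -> smooth Z B -> smooth Z K ->
  (forall x, Z x -> p1 x = L x - 1 / 2 * (B x + K x)) ->
  let K1 := fun x => theta K x + L x * K x in
  let K2 := fun x => theta K1 x + 2 * L x * K1 x in
  let K3 := fun x => theta K2 x + 3 * L x * K2 x in
  (forall x, Z x -> p2 x = 1 / 20 * (24 * K1 x - 20 * (theta B x + L x * B x + K1 x)
     + 5 * (B x + K x) ^ 2 - 8 * K x ^ 2)) ->
  (forall x, Z x -> p3 x = 1 / 50 * (- 10 * K3 x + 40 * K x * K2 x + 21 * K1 x ^ 2
     - 54 * K x ^ 2 * K1 x + 9 * K x ^ 4)) ->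
  is_theta Z u (fun x => (2 * B x + K x - 5 / 2 * L x) * u x + Y1 x) ->
  is_theta Z Y1 (fun x => (2 * B x + 2 * K x - 7 / 2 * L x) * Y1 x + Y2 x) ->
  is_theta Z Y2 (fun x => (2 * B x + 2 * K x - 9 / 2 * L x) * Y2 x + Y3 x) ->
  is_theta Z Y3 (fun x => (2 * B x + 3 * K x - 11 / 2 * L x) * Y3 x) ->
  forall x, Z x -> ode_lhs p1 p2 p3 u x = 0.
Proof.
intros HZ HZ0 sL sB sK Ep1 K1 K2 K3 Ep2 Ep3 Du DY1 DY2 DY3 x Hx.
assert (T := fun f => smooth_theta Z HZ f).
assert (DL0 := smooth_is_theta Z HZ0 L sL). assert (DB0 := smooth_is_theta Z HZ0 B sB).
assert (DK0 := smooth_is_theta Z HZ0 K sK).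
assert (DL1 := smooth_is_theta Z HZ0 _ (T _ sL)).
assert (DB1 := smooth_is_theta Z HZ0 _ (T _ sB)).
assert (DK1 := smooth_is_theta Z HZ0 _ (T _ sK)).
assert (DL2 := smooth_is_theta Z HZ0 _ (T _ (T _ sL))).
assert (DB2 := smooth_is_theta Z HZ0 _ (T _ (T _ sB))).
assert (DK2 := smooth_is_theta Z HZ0 _ (T _ (T _ sK))).
clear T sL sB sK.
(* The derivatives up to third order become opaque atoms of a polynomial ring; higher ones do not
   occur in the equation. *)
set (L1 := theta L) in *. set (L2 := theta L1) in *. set (L3 := theta L2) in *.
set (B1 := theta B) in *. set (B2 := theta B1) in *. set (B3 := theta B2) in *.
set (k1 := theta K) in *. set (k2 := theta k1) in *. set (k3 := theta k2) in *.
clearbody L1 L2 L3 B1 B2 B3 k1 k2 k3.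
eassert (dK1 : is_theta Z K1 _) by (unfold K1; is_theta_auto HZ HZ0).
cbv beta in dK1.
(* [K2] contains [theta K1], which is not an atom; its closed form is needed before [K2] can be
   differentiated. *)
assert (EK2 : forall y, Z y -> K2 y = (k2 y + (L1 y * K y + L y * k1 y)) + 2 * L y * K1 y).
{ intros y Hy. unfold K2. rewrite (is_theta_unique Z HZ0 _ _ y dK1 Hy). reflexivity. }
eassert (dK2 : is_theta Z K2 _)
  by (refine (is_theta_ext_l Z HZ _ _ _ EK2 _); is_theta_auto HZ HZ0).
eassert (Dp1 : is_theta Z p1 _)
  by (refine (is_theta_ext_l Z HZ _ _ _ Ep1 _); is_theta_auto HZ HZ0).
eassert (Dp11 : is_theta Z (theta p1) _)
  by (refine (is_theta_step Z HZ HZ0 _ _ _ Dp1 _); is_theta_auto HZ HZ0).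
eassert (Dp12 : is_theta Z (theta (theta p1)) _)
  by (refine (is_theta_step Z HZ HZ0 _ _ _ Dp11 _); is_theta_auto HZ HZ0).
eassert (Dp2 : is_theta Z p2 _)
  by (refine (is_theta_ext_l Z HZ _ _ _ Ep2 _); is_theta_auto HZ HZ0).
eassert (Dp21 : is_theta Z (theta p2) _)
  by (refine (is_theta_step Z HZ HZ0 _ _ _ Dp2 _); is_theta_auto HZ HZ0).
eassert (Du1 : is_theta Z (theta u) _)
  by (refine (is_theta_step Z HZ HZ0 _ _ _ Du _); is_theta_auto HZ HZ0).
eassert (Du2 : is_theta Z (theta (theta u)) _)
  by (refine (is_theta_step Z HZ HZ0 _ _ _ Du1 _); is_theta_auto HZ HZ0).
eassert (Du3 : is_theta Z (theta (theta (theta u))) _)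
  by (refine (is_theta_step Z HZ HZ0 _ _ _ Du2 _); is_theta_auto HZ HZ0).
unfold ode_lhs.
rewrite (is_theta_unique Z HZ0 _ _ x Du3 Hx), (is_theta_unique Z HZ0 _ _ x Du2 Hx),
  (is_theta_unique Z HZ0 _ _ x Du1 Hx), (is_theta_unique Z HZ0 _ _ x Du Hx).
rewrite (is_theta_unique Z HZ0 _ _ x Dp12 Hx), (is_theta_unique Z HZ0 _ _ x Dp11 Hx),
  (is_theta_unique Z HZ0 _ _ x Dp1 Hx).
rewrite (is_theta_unique Z HZ0 _ _ x Dp21 Hx), (is_theta_unique Z HZ0 _ _ x Dp2 Hx).
rewrite (Ep3 x Hx), (Ep2 x Hx), (Ep1 x Hx). unfold K3.
rewrite (is_theta_unique Z HZ0 _ _ x dK2 Hx), (EK2 x Hx).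
(* What remains is a polynomial identity in [u], [Y1], [Y2], [Y3], in [L], [B], [K] and in the
   atoms; all denominators are numerical. *)
unfold K1. cbv beta. clear.
field; neq_0.
Qed.

(** * Functions known through their square, and the zeros of [y] *)

Lemma open_and_nonzero (Z : C -> Prop) (f : C -> C) :
  open Z -> smooth Z f -> open (fun x => Z x /\ f x <> 0).
Proof.
intros HZ Hf x [Hx H0]. apply filter_and; [exact (HZ x Hx)|].
exact (is_Cderive_nonzero_loc f x _ (smooth_is_Cderive Z f x Hf Hx) H0).
Qed.

Lemma is_theta_sub (Z W : C -> Prop) (f f' : C -> C) :
  (forall x, W x -> Z x) -> is_theta Z f f' -> is_theta W f f'.
Proof. intros H D x Hx. apply D, H, Hx. Qed.

Lemma is_theta_of_zero (Z : C -> Prop) (f f' : C -> C) : open Z -> (forall x, Z x -> x <> 0) ->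
  is_theta Z f f' -> (forall x, Z x -> f x = 0) -> forall x, Z x -> f' x = 0.
Proof.
intros HZ HZ0 D E x Hx. rewrite <- (is_theta_unique Z HZ0 f f' x D Hx).
apply (is_theta_unique Z HZ0 _ (fun _ => RtoC 0)); [|exact Hx].
refine (is_theta_ext_l Z HZ _ _ _ E _). apply is_theta_const, HZ0.
Qed.

Ltac smooth_auto HZ :=
  cbv beta;
  lazymatch goal with
  | |- smooth _ (fun _ => ?c) => exact (smooth_const _ c)
  | |- smooth _ (fun x => _ + _) => refine (smooth_plus _ _ _ _ _); smooth_auto HZ
  | |- smooth _ (fun x => _ - _) => refine (smooth_minus _ HZ _ _ _ _); smooth_auto HZ
  | |- smooth _ (fun x => _ * _) => refine (smooth_mult _ _ _ _ _); smooth_auto HZ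
  | |- smooth _ (fun x => - _) => refine (smooth_opp _ HZ _ _); smooth_auto HZ
  | |- smooth _ (fun x => _ ^ ?n) => refine (smooth_pow _ _ n _); smooth_auto HZ
  | |- smooth _ (fun x => theta ?f x) => refine (smooth_theta _ HZ f _); smooth_auto HZ
  | |- smooth _ (theta ?f) => refine (smooth_theta _ HZ f _); smooth_auto HZ
  | H : smooth _ ?f |- smooth _ (fun x => ?f x) => exact H
  | H : smooth _ ?f |- smooth _ ?f => exact H
  end.

(** No square root of [kap] is chosen: where [y0] does not vanish, [u / y0] is one, and only its
    logarithmic derivative, half that of [kap], enters the triangular system. The assumption that
    [y0], ..., [y3] have no common zero is what excludes that [y0] vanishes on an open set. *)
Lemma ode_of_sqr (Z : C -> Prop) (L B K p1 p2 p3 y0 y1 y2 y3 kap u : C -> C) :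
  open Z -> (forall x, Z x -> x <> 0) ->
  smooth Z L -> smooth Z B -> smooth Z K ->
  (forall x, Z x -> p1 x = L x - 1 / 2 * (B x + K x)) ->
  let K1 := fun x => theta K x + L x * K x in
  let K2 := fun x => theta K1 x + 2 * L x * K1 x in
  let K3 := fun x => theta K2 x + 3 * L x * K2 x in
  (forall x, Z x -> p2 x = 1 / 20 * (24 * K1 x - 20 * (theta B x + L x * B x + K1 x)
     + 5 * (B x + K x) ^ 2 - 8 * K x ^ 2)) ->
  (forall x, Z x -> p3 x = 1 / 50 * (- 10 * K3 x + 40 * K x * K2 x + 21 * K1 x ^ 2
     - 54 * K x ^ 2 * K1 x + 9 * K x ^ 4)) ->
  smooth Z y0 ->
  is_theta Z y0 y1 ->
  is_theta Z y1 (fun x => (K x - L x) * y1 x + y2 x) ->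
  is_theta Z y2 (fun x => (K x - 2 * L x) * y2 x + y3 x) ->
  is_theta Z y3 (fun x => (2 * K x - 3 * L x) * y3 x) ->
  (forall x, Z x -> ~ (y0 x = 0 /\ y1 x = 0 /\ y2 x = 0 /\ y3 x = 0)) ->
  (forall x, Z x -> kap x <> 0) ->
  is_theta Z kap (fun x => 2 * (2 * B x + K x - 5 / 2 * L x) * kap x) ->
  smooth Z u ->
  (forall x, Z x -> u x ^ 2 = kap x * y0 x ^ 2) ->
  forall x, Z x -> ode_lhs p1 p2 p3 u x = 0.
Proof.
intros HZ HZ0 sL sB sK Ep1 K1 K2 K3 Ep2 Ep3 sy D0 D1 D2 D3 NV kap0 Dkap su Eu.
set (Z' := fun x => Z x /\ y0 x <> 0).
assert (HZ' : open Z') by (apply open_and_nonzero; assumption).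
assert (sub : forall x, Z' x -> Z x) by (intros x [Hx _]; exact Hx).
assert (HZ0' : forall x, Z' x -> x <> 0) by auto.
assert (on_Z' : forall x, Z' x -> ode_lhs p1 p2 p3 u x = 0).
{ set (m := fun x => u x * / y0 x).
  assert (Du := is_theta_sub Z Z' _ _ sub (smooth_is_theta Z HZ0 u su)).
  assert (D0' := is_theta_sub Z Z' _ _ sub D0). assert (D1' := is_theta_sub Z Z' _ _ sub D1).
  assert (D2' := is_theta_sub Z Z' _ _ sub D2). assert (D3' := is_theta_sub Z Z' _ _ sub D3).
  assert (Dm0 := is_theta_mult Z' HZ0' _ _ _ _ Du (is_theta_inv Z' HZ0' _ _ (fun x (H : Z' x)
    => proj2 H) D0')).
  cbv beta in Dm0. fold m in Dm0.
  set (m' := fun x => theta u x * / y0 x + u x * (- y1 x / (y0 x * y0 x))) in Dm0.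
  assert (Em : forall x, Z' x -> m x * m x = kap x).
  { intros x [Hx H0]. unfold m.
    replace (u x * / y0 x * (u x * / y0 x)) with (u x ^ 2 * / (y0 x ^ 2)) by (field; neq_0).
    rewrite (Eu x Hx). field; neq_0. }
  assert (Dm : is_theta Z' m (fun x => (2 * B x + K x - 5 / 2 * L x) * m x)).
  { apply (is_theta_ext Z' HZ' m m'); [reflexivity| |exact Dm0]. intros x Hx.
    (* Differentiating [m * m = kap] in two ways gives [2 m m' = theta kap], which is solved for
       [m'] since [kap], hence [m], has no zero. *)
    assert (E1 := is_theta_unique Z' HZ0' _ _ x (is_theta_mult Z' HZ0' _ _ _ _ Dm0 Dm0) Hx).
    assert (E2 := is_theta_unique Z' HZ0' _ _ x (is_theta_ext_l Z' HZ' _ _ _ Em (is_theta_sub Z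
      Z' _ _ sub Dkap)) Hx).
    cbv beta in E1. rewrite E1 in E2. rewrite <- (Em x Hx) in E2.
    assert (Hm : m x <> 0).
    { intros E. apply (kap0 x (sub x Hx)). rewrite <- (Em x Hx), E. ring. }
    assert (H2 : RtoC 2 <> 0) by (apply RtoC_neq_0; lra).
    transitivity ((m' x * m x + m x * m' x) / (2 * m x)); [field; neq_0|].
    rewrite E2. field; neq_0. }
  apply (ode_of_triangular_system Z' L B K p1 p2 p3 (fun x => m x * y1 x) (fun x =>
    m x * y2 x) (fun x => m x * y3 x) u);
    try assumption; try (apply (smooth_sub Z); assumption); try (intros x Hx; auto; fail).
  - apply (is_theta_ext Z' HZ' (fun x => m x * y0 x) (fun x =>
      (2 * B x + K x - 5 / 2 * L x) * m x * y0 x + m x * y1 x)).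
    + intros x [Hx H0]. unfold m. field; neq_0.
    + intros x [Hx H0]. unfold m. field; neq_0.
    + is_theta_auto HZ' HZ0'.
  - eapply (is_theta_ext Z' HZ'); [reflexivity| |is_theta_auto HZ' HZ0']. intros x _. cbv beta.
    field; neq_0.
  - eapply (is_theta_ext Z' HZ'); [reflexivity| |is_theta_auto HZ' HZ0']. intros x _. cbv beta.
    field; neq_0.
  - eapply (is_theta_ext Z' HZ'); [reflexivity| |is_theta_auto HZ' HZ0']. intros x _. cbv beta.
    field; neq_0. }
assert (sp1 : smooth Z p1).
{ eapply (smooth_ext Z HZ); [intros y Hy; symmetry; exact (Ep1 y Hy)|]. smooth_auto HZ. }
assert (sK1 : smooth Z K1) by (unfold K1; smooth_auto HZ).
assert (sK2 : smooth Z K2) by (unfold K2; smooth_auto HZ).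
assert (sK3 : smooth Z K3) by (unfold K3; smooth_auto HZ).
assert (sp2 : smooth Z p2).
{ eapply (smooth_ext Z HZ); [intros y Hy; symmetry; exact (Ep2 y Hy)|]. smooth_auto HZ. }
assert (sp3 : smooth Z p3).
{ eapply (smooth_ext Z HZ); [intros y Hy; symmetry; exact (Ep3 y Hy)|]. smooth_auto HZ. }
assert (sE : smooth Z (ode_lhs p1 p2 p3 u)) by (unfold ode_lhs; smooth_auto HZ).
intros x Hx. destruct (Ceq_dec (ode_lhs p1 p2 p3 u x) 0) as [E|NE]; [exact E|exfalso].
(* The set where the equation fails is open, and by the case already settled [y0] vanishes on it.
   Differentiating along the chain [D0], [D1], [D2] then makes [y1], [y2], [y3] vanish there too,
   against [NV]. *)
set (W := fun x => Z x /\ ode_lhs p1 p2 p3 u x <> 0).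
assert (HW : open W) by (apply open_and_nonzero; assumption).
assert (subW : forall x, W x -> Z x) by (intros y [Hy _]; exact Hy).
assert (HW0 : forall x, W x -> x <> 0) by auto.
assert (z0 : forall y, W y -> y0 y = 0).
{ intros y [Hy Hn]. destruct (Ceq_dec (y0 y) 0) as [E|N]; [exact E|].
  destruct (Hn (on_Z' y (conj Hy N))). }
assert (z1 := is_theta_of_zero W _ _ HW HW0 (is_theta_sub Z W _ _ subW D0) z0).
assert (z2 : forall y, W y -> y2 y = 0).
{ intros y Hy.
  assert (Q := is_theta_of_zero W _ _ HW HW0 (is_theta_sub Z W _ _ subW D1) z1 y Hy).
  cbv beta in Q.
  rewrite (z1 y Hy) in Q. rewrite <- Q. ring. }
assert (z3 : forall y, W y -> y3 y = 0).
{ intros y Hy.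
  assert (Q := is_theta_of_zero W _ _ HW HW0 (is_theta_sub Z W _ _ subW D2) z2 y Hy).
  cbv beta in Q.
  rewrite (z2 y Hy) in Q. rewrite <- Q. ring. }
assert (Wx : W x) by (split; assumption).
apply (NV x Hx). auto.
Qed.

(** * Change of coordinate from tau to z *)

(** A finite value at [a] forces the pole order 0, and then [f a = c 0] is the value of the series
    at its centre, so the expansion on the punctured disc holds on the full one. *)
Lemma mero_at_regular (f : C -> option C) (a : C) : mero_at f a -> f a <> None ->
  analytic_at (val f) a /\ locally a (fun x => f x <> None).
Proof.
intros [m [c [[r [Hr Hl]] [[Hm Ha]|[_ [_ Ha]]]]]] Hn; [|contradiction]. subst m.
split.
- exists c, r. split; [exact Hr|]. intros x Hx. destruct (Ceq_dec x a) as [->|N].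
  + unfold val. rewrite Ha. replace (a - a) with (RtoC 0) by ring.
    exact (is_pseries_0 (V:=C_NormedModule) c).
  + destruct (Hl x N Hx) as [y [Ey Hy]]. unfold val. rewrite Ey. simpl in Hy.
    rewrite Cmult_1_r in Hy. exact Hy.
- apply locally_Cmod. exists r. split; [exact Hr|]. intros x Hx.
  destruct (Ceq_dec x a) as [->|N]; [exact Hn|].
  destruct (Hl x N Hx) as [y [Ey _]]. congruence.
Qed.

Lemma smooth_logder (V : C -> Prop) (f : C -> C) :
  open V -> smooth V f -> (forall x, V x -> f x <> 0) -> smooth V (logder f).
Proof.
intros HV sf f0.
apply (smooth_div V HV (C_derive f) f); [exact f0|apply smooth_C_derive|]; assumption.
Qed.

Section Pullback.
Variables (V Z : C -> Prop) (zf tau : C -> C).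
Hypotheses (HV : open V) (HZ : open Z) (HZ0 : forall x, Z x -> x <> 0).
Hypotheses (sz : smooth V zf) (z0 : forall s, V s -> zf s <> 0) (z1 : forall s,
    V s -> C_derive zf s <> 0).
Hypotheses (stau : smooth Z tau) (tauV : forall x, Z x -> V (tau x)) (ztau : forall x,
    Z x -> zf (tau x) = x).

Let G1 := logder zf.
Let a (x : C) := G1 (tau x).

Lemma pullback_G1_neq_0 x : Z x -> a x <> 0.
Proof.
intros Hx E. apply (z1 (tau x) (tauV x Hx)).
transitivity (a x * zf (tau x)); [|rewrite E; ring]. unfold a, G1, logder. field. auto.
Qed.

(** From [zf (tau x) = x] the chain rule gives [x tau'(x) = zf / zf'] at [tau x], which is [1 / G1]:
    in the coordinate [tau], [theta] is [D / G1]. *)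
Lemma pullback_is_theta (F F' : C -> C) : (forall s, V s -> is_Cderive F s (F' s)) ->
  is_theta Z (fun x => F (tau x)) (fun x => F' (tau x) / a x).
Proof.
intros HF x Hx. assert (Vx := tauV x Hx). assert (Dt := smooth_is_Cderive Z tau x stau Hx).
assert (E : C_derive tau x * C_derive zf (tau x) = 1).
{ rewrite <- (is_C_derive_unique _ _ _ (is_Cderive_comp zf tau x _ _ (smooth_is_Cderive V zf _
    sz Vx) Dt)).
  apply is_C_derive_unique.
  apply (is_Cderive_ext_on Z HZ (fun y => y)); [|exact Hx|apply is_Cderive_id].
  intros y Hy. symmetry. auto. }
apply (is_Cderive_eq _ _ (C_derive tau x * F' (tau x))); [apply is_Cderive_comp; auto|].
unfold a, G1, logder. rewrite (ztau x Hx). specialize (z1 _ Vx). specialize (HZ0 x Hx).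
replace (C_derive tau x) with (/ C_derive zf (tau x)).
- field; neq_0.
- transitivity (C_derive tau x * C_derive zf (tau x) * / C_derive zf (tau x)); [rewrite E;
    ring|field; neq_0].
Qed.

(* The derivation theta sends weight k to weight k + 1 up to the correction -k L, so
   the formulas below have no denominators. *)
Definition weighted_pullback (k : nat) (F : C -> C) (x : C) : C := F (tau x) * (/ a x) ^ k.

Let L := weighted_pullback 2 (C_derive G1).

Lemma smooth_G1 : smooth V G1.
Proof. apply smooth_logder; assumption. Qed.

Lemma is_theta_inv_G1 : is_theta Z (fun x => / a x) (fun x => - L x * / a x).
Proof.
assert (H := pullback_is_theta G1 (C_derive G1) (fun s Hs =>
  smooth_is_Cderive V G1 s smooth_G1 Hs)).
refine (is_theta_ext Z HZ _ _ _ _ (fun x _ =>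
  eq_refl) _ (is_theta_inv Z HZ0 _ _ pullback_G1_neq_0 H)).
intros x Hx. cbv beta. unfold L, weighted_pullback. field. exact (pullback_G1_neq_0 x Hx).
Qed.

Lemma is_theta_weighted_pullback k (F F' : C -> C) :
  (forall s, V s -> is_Cderive F s (F' s)) ->
  is_theta Z (weighted_pullback k F) (fun x =>
    weighted_pullback (S k) F' x - INR k * L x * weighted_pullback k F x).
Proof.
intros HF.
assert (P : is_theta Z (fun x => (/ a x) ^ k) (fun x => - (INR k * L x) * (/ a x) ^ k)).
{ induction k as [|k IH].
  - apply (is_theta_ext Z HZ (fun _ => RtoC 1) (fun _ => RtoC 0)); [reflexivity|intros; simpl;
      ring|].
    apply is_theta_const, HZ0.
  - apply (is_theta_ext Z HZ (fun x => / a x * (/ a x) ^ k) (fun x =>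
      - L x * / a x * (/ a x) ^ k + / a x * (- (INR k * L x) * (/ a x) ^ k))).
    + reflexivity.
    + intros x _. rewrite S_INR, RtoC_plus. simpl Cpow. ring.
    + apply is_theta_mult; [exact HZ0|exact is_theta_inv_G1|exact IH]. }
refine (is_theta_ext Z HZ _ _ _ _ (fun x _ =>
  eq_refl) _ (is_theta_mult Z HZ0 _ _ _ _ (pullback_is_theta F F' HF) P)).
intros x Hx. unfold weighted_pullback. simpl Cpow. unfold Cdiv. ring.
Qed.

Lemma theta_weighted_pullback k (F : C -> C) x :
  smooth V F -> Z x ->
  theta (weighted_pullback k F) x
    = weighted_pullback (S k) (C_derive F) x - INR k * L x * weighted_pullback k F x.
Proof.
intros sF Hx. refine (is_theta_unique Z HZ0 _ _ x (is_theta_weighted_pullback k F _ _) Hx).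
intros s Hs. apply (smooth_is_Cderive V); assumption.
Qed.

Lemma smooth_weighted_pullback k (F : C -> C) : smooth V F -> smooth Z (weighted_pullback k F).
Proof.
intros sF. apply (smooth_mult Z (fun x => F (tau x)) (fun x => (/ a x) ^ k)).
- apply (smooth_comp Z V F tau); assumption.
- apply (smooth_pow Z (fun x => / a x)), smooth_inv; [exact HZ|exact pullback_G1_neq_0|].
  apply (smooth_comp Z V G1 tau); [assumption|apply smooth_G1|assumption].
Qed.

Lemma ode_pullback (wf v Y q r P d : C -> C) (kappa : C) :
  let G2 := logder wf in
  let G3 := logder v in
  let p1 := fun x => p1_tau G1 G2 G3 (tau x) in
  let p2 := fun x => p2_tau G1 G2 G3 (tau x) in
  let p3 := fun x => p3_tau G1 G3 (tau x) in
  smooth V wf -> (forall s, V s -> wf s <> 0) ->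
  smooth V v -> (forall s, V s -> v s <> 0) ->
  (forall s, V s -> is_Cderive Y s (v s * q s)) ->
  (forall s, V s -> is_Cderive q s (r s)) ->
  (forall s, V s -> is_Cderive r s (v s * kappa)) ->
  (forall s, V s -> ~ (Y s = 0 /\ q s = 0 /\ r s = 0 /\ kappa = 0)) ->
  (forall x, Z x -> is_Cderive P x (p1 x / x)) ->
  smooth Z d ->
  (forall x, Z x -> d x ^ 2 = wf (tau x) ^ 2 / a x * Y (tau x) ^ 2) ->
  forall x, Z x -> ode_lhs p1 p2 p3 (fun x => Cexp (- 2 * P x) * d x) x = 0.
Proof.
intros G2 G3 p1 p2 p3 sw w0 sv v0 DY Dq Dr NV DP sd Ed.
assert (a0 := pullback_G1_neq_0).
assert (s1 := smooth_G1).
assert (s2 : smooth V G2) by (apply smooth_logder; assumption).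
assert (s3 : smooth V G3) by (apply smooth_logder; assumption).
assert (s31 := smooth_C_derive V HV _ s3). assert (s32 := smooth_C_derive V HV _ s31).
set (B := weighted_pullback 1 G2). set (K := weighted_pullback 1 G3).
assert (Ep1 : forall x, Z x -> p1 x = L x - 1 / 2 * (B x + K x)).
{ intros x Hx. specialize (a0 x Hx). unfold p1, p1_tau, L, B, K, weighted_pullback. fold (a x).
  field; neq_0. }
assert (sr : smooth V r).
{ apply (smooth_primitive V r _ Dr).
  apply (smooth_mult V v (fun _ => kappa)); [assumption|apply smooth_const]. }
assert (sq : smooth V q) by (apply (smooth_primitive V q r); assumption).
assert (sY : smooth V Y).
{ apply (smooth_primitive V Y _ DY). apply (smooth_mult V v q); assumption. }
set (K1 := fun x => theta K x + L x * K x).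
set (K2 := fun x => theta K1 x + 2 * L x * K1 x).
set (K3 := fun x => theta K2 x + 3 * L x * K2 x).
assert (EK1 : forall x, Z x -> K1 x = weighted_pullback 2 (C_derive G3) x).
{ intros x Hx. unfold K1, K. rewrite (theta_weighted_pullback 1 G3 x s3 Hx). simpl INR. ring. }
assert (EK2 : forall x, Z x -> K2 x = weighted_pullback 3 (C_derive (C_derive G3)) x).
{ intros x Hx. unfold K2.
  rewrite (theta_ext_on Z HZ HZ0 _ _ x EK1 (smooth_weighted_pullback 2 _ s31) Hx),
    (theta_weighted_pullback 2 _ x s31 Hx), (EK1 x Hx).
  replace (INR 2) with 2%R by (simpl; lra). ring. }
assert (EK3 : forall x, Z x -> K3 x
  = weighted_pullback 4 (C_derive (C_derive (C_derive G3))) x).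
{ intros x Hx. unfold K3.
  rewrite (theta_ext_on Z HZ HZ0 _ _ x EK2 (smooth_weighted_pullback 3 _ s32) Hx),
    (theta_weighted_pullback 3 _ x s32 Hx), (EK2 x Hx).
  replace (INR 3) with 3%R by (simpl; lra). ring. }
assert (Dv : forall s, V s -> is_Cderive v s (G3 s * v s)).
{ intros s Hs.
  apply (is_Cderive_eq _ _ (C_derive v s)); [apply (smooth_is_Cderive V); assumption|].
  unfold G3, logder. field; auto. }
assert (Dw : forall s, V s -> is_Cderive wf s (G2 s * wf s)).
{ intros s Hs.
  apply (is_Cderive_eq _ _ (C_derive wf s)); [apply (smooth_is_Cderive V); assumption|].
  unfold G2, logder. field; auto. }
assert (sP : smooth Z P).
{ apply (smooth_primitive Z P _ DP).
  apply (smooth_div Z HZ p1 (fun x => x)); [exact HZ0| |apply smooth_id].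
  eapply (smooth_ext Z HZ); [intros y Hy; symmetry; exact (Ep1 y Hy)|].
  assert (sL : smooth Z L) by (apply smooth_weighted_pullback, smooth_C_derive; assumption).
  assert (sB : smooth Z B) by (apply smooth_weighted_pullback; assumption).
  assert (sK : smooth Z K) by (apply smooth_weighted_pullback; assumption).
  smooth_auto HZ. }
assert (Dg : is_theta Z (fun x => Cexp (- 2 * P x)) (fun x => - 2 * p1 x * Cexp (- 2 * P x))).
{ intros x Hx. apply (is_Cderive_eq _ _ ((0 * P x + - 2 * (p1 x / x)) * Cexp (- 2 * P x))).
  - apply (is_Cderive_comp Cexp (fun x => - 2 * P x)); [apply is_Cderive_Cexp|].
    apply (is_Cderive_mult (fun _ => - 2) P); [apply is_Cderive_const|auto].
  - field; auto. }
assert (su : smooth Z (fun x => Cexp (- 2 * P x) * d x)).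
{ apply (smooth_mult Z (fun x => Cexp (- 2 * P x)) d); [|exact sd].
  apply (smooth_comp Z (fun _ => True) Cexp (fun x => - 2 * P x));
    [trivial|apply smooth_Cexp|smooth_auto HZ].
  }
(* The weights are 0, 1, 2, 3 because each [theta] divides by one more [G1]. The factor [v] comes
   once from [Y' = v q] and a second time from [r' = v kappa]. The multiplier is
   [kap = g^2 w^2 / G1]. *)
apply (ode_of_sqr Z L B K p1 p2 p3 (weighted_pullback 0 Y) (weighted_pullback 1 (fun s =>
  v s * q s)) (weighted_pullback 2 (fun s => v s * r s))
   (weighted_pullback 3 (fun s => v s * v s * kappa)) (fun x =>
     Cexp (- 2 * P x) ^ 2 * wf (tau x) ^ 2 * / a x) (fun x => Cexp (- 2 * P x) * d x));
     try assumption.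
- apply smooth_weighted_pullback, smooth_C_derive; assumption.
- apply smooth_weighted_pullback; assumption.
- apply smooth_weighted_pullback; assumption.
- intros x Hx.
  change (p2 x = 1 / 20 * (24 * K1 x - 20 * (theta B x + L x * B x + K1 x) + 5 * (B x + K x) ^
    2 - 8 * K x ^ 2)).
  rewrite (EK1 x Hx). unfold B at 1. rewrite (theta_weighted_pullback 1 G2 x s2 Hx).
  specialize (a0 x Hx). unfold p2, p2_tau.
  assert (E : C_derive (fun s => G2 s + G3 s) (tau x)
    = C_derive G2 (tau x) + C_derive G3 (tau x))
    by exact (is_C_derive_unique _ _ _ (is_Cderive_plus G2 G3 (tau x) _ _ (smooth_is_Cderive V
      G2 _ s2 (tauV x Hx)) (smooth_is_Cderive V G3 _ s3 (tauV x Hx)))).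
  rewrite E. unfold B, K, weighted_pullback. simpl INR. fold (a x). field; neq_0.
- intros x Hx.
  change (p3 x = 1 / 50 * (- 10 * K3 x + 40 * K x * K2 x + 21 * K1 x ^ 2 - 54 * K x ^ 2 * K1 x
    + 9 * K x ^ 4)).
  rewrite (EK1 x Hx), (EK2 x Hx), (EK3 x Hx). specialize (a0 x Hx).
  unfold p3, p3_tau, K, weighted_pullback. fold (a x). field; neq_0.
- apply smooth_weighted_pullback; assumption.
- refine (is_theta_ext Z HZ _ _ _ _ (fun x _ =>
    eq_refl) _ (is_theta_weighted_pullback 0 Y _ DY)).
  intros x Hx. cbv beta. simpl INR. ring.
- refine (is_theta_ext Z HZ _ _ _ _ (fun x _ =>
    eq_refl) _ (is_theta_weighted_pullback 1 _ (fun s => G3 s * v s * q s + v s * r s) _)).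
  + intros x Hx. unfold K, weighted_pullback. simpl INR. simpl Cpow. ring.
  + intros s Hs. apply is_Cderive_mult; auto.
- refine (is_theta_ext Z HZ _ _ _ _ (fun x _ =>
    eq_refl) _ (is_theta_weighted_pullback 2 _ (fun s =>
    G3 s * v s * r s + v s * (v s * kappa)) _)).
  + intros x Hx. replace (INR 2) with 2%R by (simpl; lra). unfold K, weighted_pullback.
    simpl Cpow. ring.
  + intros s Hs. apply is_Cderive_mult; auto.
- refine (is_theta_ext Z HZ _ _ _ _ (fun x _ =>
    eq_refl) _ (is_theta_weighted_pullback 3 _ (fun s =>
    (G3 s * v s * v s + v s * (G3 s * v s)) * kappa + v s * v s * 0) _)).
  + intros x Hx. replace (INR 3) with 3%R by (simpl; lra). unfold K, weighted_pullback.
    simpl Cpow. ring.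
  + intros s Hs.
    apply (is_Cderive_mult (fun s => v s * v s) (fun _ => kappa)); [apply is_Cderive_mult;
      auto|apply is_Cderive_const].
- intros x Hx [E0 [E1 [E2 E3]]]. specialize (a0 x Hx). assert (vx := v0 _ (tauV x Hx)).
  assert (N : forall k, (/ a x) ^ k <> 0).
  { intros k. apply Cpow_nz. intros E. apply (RtoC_neq_0 1 R1_neq_R0).
  rewrite <- (Cinv_r (a x) a0), E. ring. }
  assert (Cz : forall b k, b * (/ a x) ^ k = 0 -> b = 0).
  { intros b k E. destruct (Ceq_dec b 0) as [|Nb]; [assumption|].
    destruct (Cmult_neq_0 _ _ Nb (N k) E). }
  assert (Cv : forall b, v (tau x) * b = 0 -> b = 0).
  { intros b E. destruct (Ceq_dec b 0) as [|Nb]; [assumption|].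
    destruct (Cmult_neq_0 _ _ vx Nb E). }
  apply (NV _ (tauV x Hx)). repeat split.
  + exact (Cz _ _ E0).
  + exact (Cv _ (Cz _ _ E1)).
  + exact (Cv _ (Cz _ _ E2)).
  + apply Cv, Cv. rewrite <- (Cz _ _ E3). ring.
- intros x Hx. specialize (a0 x Hx). apply Cmult_neq_0; [apply Cmult_neq_0|].
  + apply Cpow_nz. intros E. apply (RtoC_neq_0 1 R1_neq_R0).
    transitivity (Cexp (- 2 * P x) * Cexp (2 * P x)); [|rewrite E; ring].
    rewrite <- Cexp_plus. replace (- 2 * P x + 2 * P x) with (RtoC 0) by ring.
    unfold Cexp. simpl. rewrite exp_0, cos_0, sin_0. ring.
  + apply Cpow_nz. auto.
  + intros E. apply (RtoC_neq_0 1 R1_neq_R0). rewrite <- (Cinv_r (a x) a0), E. ring.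
(* The logarithmic derivative of [g^2 w^2 / G1] is [-4 p1 + 2 B - L]; inserting [p1 = L - (B + K)/2]
   yields [4 B + 2 K - 5 L]. *)
- assert (Dw' := pullback_is_theta wf _ Dw). assert (Da := is_theta_inv_G1).
  set (g := fun x => Cexp (- 2 * P x)) in *. set (wt := fun x => wf (tau x)) in *.
  set (ia := fun x => / a x) in *.
  change (is_theta Z (fun x => g x ^ 2 * wt x ^ 2 * ia x) (fun x =>
    2 * (2 * B x + K x - 5 / 2 * L x) * (g x ^ 2 * wt x ^ 2 * ia x))).
  eapply (is_theta_ext Z HZ); [reflexivity| |is_theta_auto HZ HZ0].
  intros x Hx. cbv beta. rewrite (Ep1 x Hx). specialize (a0 x Hx).
  unfold B, K, wt, ia, g, weighted_pullback. simpl Cpow. field; neq_0.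
- intros x Hx. rewrite Cpow_mult_l, (Ed x Hx). unfold weighted_pullback. simpl Cpow.
  unfold Cdiv. ring.
Qed.
End Pullback.

(** * The four determinants on the curve *)

Theorem theorem6
  (Gam : M4 -> Prop) (H : C -> Prop) (t : C -> option C) (c1 c2 : C)
  (z w : M2 -> option C) (chi : M4 -> C)
  (h_standing : standing_assumptions Gam H t c1 c2)
  (h_z_mero : mero_on_curve H t c1 c2 z)
  (h_w_mero : mero_on_curve H t c1 c2 w)
  (h_z_nonconst : nonconstant_on (curve H t c1 c2) z)
  (h_w_nonconst : nonconstant_on (curve H t c1 c2) w)
  (h_chi : is_character Gam chi)
  (h_z : forall g T, Gam g -> curve H t c1 c2 T -> z (act g T) = z T)
  (h_w : forall g T, Gam g -> curve H t c1 c2 T ->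
     w (act g T) = option_map (fun y => chi g * det2 (CTD g T) * y) (w T))
  (* a branch of T over U, and over Z a branch of the inverse of tau |-> z *)
  (U : C -> Prop) (tau2 tau3 : C -> C)
  (h_branch : is_branch H t c1 c2 U tau2 tau3)
  (Z : C -> Prop) (tau : C -> C)
  (h_Z : open Z) (h_tau : analytic_on Z tau) :
  let T := fun s => sym2 s (tau2 s) (tau3 s) in
  let v := C_derive (val t) in
  let G1 := logder (fun s => val z (T s)) in
  let G2 := logder (fun s => val w (T s)) in
  let G3 := logder v in
  (* on Z the inverse branch is defined and p1, p2, p3 make sense *)
  (forall x, Z x ->
     U (tau x) /\ z (T (tau x)) = Some x /\ x <> 0 /\ v (tau x) <> 0 /\
     w (T (tau x)) <> None /\ w (T (tau x)) <> Some (RtoC 0)) ->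
  let p1 := fun x => p1_tau G1 G2 G3 (tau x) in
  let p2 := fun x => p2_tau G1 G2 G3 (tau x) in
  let p3 := fun x => p3_tau G1 G3 (tau x) in
  let w0 := fun x => val w (T (tau x)) in
  let w1 := fun x => tau x * w0 x in
  let w3 := fun x => tau3 (tau x) * w0 x in
  let w4 := fun x => (tau x * tau3 (tau x) - tau2 (tau x) ^ 2) * w0 x in
  forall P : C -> C,
  (forall x, Z x -> @is_derive C_AbsRing C_NormedModule P x (p1 x / x)) ->
  let g := fun x => Cexp (- 2 * P x) in
  forall f h : C -> C,
  In (f, h) [(w0, w1); (w0, w3); (w1, w4); (w3, w4)] ->
  forall d : C -> C, analytic_on Z d ->
  (forall x, Z x -> d x ^ 2 = f x * theta h x - theta f x * h x) ->
  let u := fun x => g x * d x in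
  forall x, Z x ->
    theta (theta (theta (theta u))) x
    + 16 * p1 x * theta (theta (theta u)) x
    + 1 / 2 * (187 * p1 x ^ 2 + 5 * p2 x + 38 * theta p1 x) * theta (theta u) x
    + 1 / 2 * (22 * theta (theta p1) x + 5 * theta p2 x + 294 * p1 x * theta p1 x
               + 472 * p1 x ^ 3 + 40 * p1 x * p2 x) * theta u x
    + 1 / 16 * (- 8 * p3 x + 9 * p2 x ^ 2 + 12 * theta (theta p2) x
                + 40 * theta (theta (theta p1)) x + 160 * p1 x * theta p2 x
                + 124 * p2 x * theta p1 x + 4420 * p1 x ^ 2 * theta p1 x
                + 680 * p1 x * theta (theta p1) x + 460 * theta p1 x ^ 2
                + 622 * p1 x ^ 2 * p2 x + 3465 * p1 x ^ 4) * u x = 0.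
Proof.
intros T v G1 G2 G3 Hx p1 p2 p3 w0 w1 w3 w4 P HP g f h Hin d Hd Ed u.
set (zf := fun s => val z (T s)) in *. set (wf := fun s => val w (T s)) in *. set (tf := val t).
destruct h_branch as [HU Hbr].
assert (zM := h_z_mero U tau2 tau3 (conj HU Hbr)).
assert (wM := h_w_mero U tau2 tau3 (conj HU Hbr)).
set (V0 := fun s => U s /\ z (T s) <> None /\ w (T s) <> None).
assert (HV0 : open V0).
{ intros s [Us [zs ws]]. apply filter_and; [exact (HU s Us)|]. apply filter_and.
  - exact (proj2 (mero_at_regular (fun s => z (T s)) s (zM s Us) zs)).
  - exact (proj2 (mero_at_regular (fun s => w (T s)) s (wM s Us) ws)). }
assert (sz : smooth V0 zf).
{ apply smooth_analytic. intros s [Us [zs ws]].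
  exact (proj1 (mero_at_regular (fun s => z (T s)) s (zM s Us) zs)). }
assert (sw : smooth V0 wf).
{ apply smooth_analytic. intros s [Us [zs ws]].
  exact (proj1 (mero_at_regular (fun s => w (T s)) s (wM s Us) ws)). }
assert (stf : smooth V0 tf).
{ apply smooth_analytic. intros s [Us _]. destruct (Hbr s Us) as [Hs [ts _]].
  exact (proj1 (mero_at_regular t s (st_mero _ _ _ _ _ h_standing s Hs) ts)). }
assert (sv : smooth V0 v) by (apply smooth_C_derive; assumption).
assert (sz' := smooth_C_derive V0 HV0 _ sz).
(* The four conditions of nonvanishing are collected in one product, so that they cut out an open
   set at once. *)
set (N := fun s => zf s * C_derive zf s * (wf s * v s)).
assert (sN : smooth V0 N) by (unfold N; smooth_auto HV0).
set (V := fun s => V0 s /\ N s <> 0).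
assert (HV : open V) by (apply open_and_nonzero; assumption).
assert (sub : forall s, V s -> V0 s) by (intros s [Hs _]; exact Hs).
assert (HVn : forall s, V s -> zf s <> 0 /\ C_derive zf s <> 0 /\ wf s <> 0 /\ v s <> 0).
{ intros s [_ Hn]. unfold N in Hn. repeat split; intros E; apply Hn; rewrite E; ring. }
assert (stau : smooth Z tau) by (apply smooth_analytic; assumption).
assert (ztau : forall x, Z x -> zf (tau x) = x).
{ intros x Zx. unfold zf, val. destruct (Hx x Zx) as [_ [-> _]]. reflexivity. }
assert (HZ0 : forall x, Z x -> x <> 0) by (intros x Zx; apply (Hx x Zx)).
assert (tauV : forall x, Z x -> V (tau x)).
{ intros x Zx. destruct (Hx x Zx) as [Ux [zx [x0 [vx [wn wx]]]]].
  assert (V0x : V0 (tau x)) by (split; [exact Ux|split; [congruence|exact wn]]).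
  split; [exact V0x|]. unfold N. rewrite (ztau x Zx).
  repeat apply Cmult_neq_0; try assumption.
  (* [zf] has the right inverse [tau], so by the chain rule a zero of its derivative at [tau x]
     would give [1 = 0]. *)
  - intros E. apply (RtoC_neq_0 1 R1_neq_R0).
    assert (D := is_Cderive_comp zf tau x _ _ (smooth_is_Cderive V0 zf _ sz V0x)
      (smooth_is_Cderive Z tau _ stau Zx)).
    assert (D' : is_Cderive (fun y => zf (tau y)) x 1).
    { apply (is_Cderive_ext_on Z h_Z (fun y => y)); [|exact Zx|apply is_Cderive_id].
      intros y Zy. symmetry. auto. }
    rewrite <- (is_C_derive_unique _ _ _ D'), (is_C_derive_unique _ _ _ D), E. ring.
  - unfold wf, val. destruct (w (T (tau x))); congruence. }
assert (D2 : forall s, V s -> is_Cderive tau2 s (- tf s)).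
{ intros s Vs. destruct (Hbr s (proj1 (sub s Vs))) as [_ [_ [D _]]]. exact D. }
assert (D3 : forall s, V s -> is_Cderive tau3 s (tf s * tf s)).
{ intros s Vs. destruct (Hbr s (proj1 (sub s Vs))) as [_ [_ [_ [D _]]]]. exact D. }
assert (Dt : forall s, V s -> is_Cderive tf s (v s)).
{ intros s Vs. apply (smooth_is_Cderive V0); auto. }
assert (Dw : forall s, V s -> is_Cderive wf s (G2 s * wf s)).
{ intros s Vs. apply (is_Cderive_eq _ _ (C_derive wf s)); [apply (smooth_is_Cderive V0); auto|].
  unfold G2, logder. field. apply (HVn s Vs). }
assert (pull := fun F F' => pullback_is_theta V Z zf tau h_Z HZ0 (smooth_sub V0 V _ sub sz)
  (fun s Vs => proj1 (proj2 (HVn s Vs))) stau tauV ztau F F').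
fold G1 in pull.
assert (a0 : forall x, Z x -> G1 (tau x) <> 0).
{ apply (pullback_G1_neq_0 V Z zf tau); [intros s Vs; apply (HVn s Vs)|intros s Vs;
    apply (HVn s Vs)|exact tauV].
  }
(* For [f = a w] and [h = b w] the terms with [theta w] cancel, and [w^2 (a theta b - b theta a)]
   remains; the second factor turns out to be [Y^2 / G1]. In each case one of [Y], [q], [r], [kappa]
   is the constant 1 or -1, which rules out a common zero. *)
assert (main : exists (Y q r : C -> C) (kappa : C),
  (forall s, V s -> is_Cderive Y s (v s * q s)) /\
  (forall s, V s -> is_Cderive q s (r s)) /\
  (forall s, V s -> is_Cderive r s (v s * kappa)) /\
  (forall s, V s -> ~ (Y s = 0 /\ q s = 0 /\ r s = 0 /\ kappa = 0)) /\
  (forall x, Z x -> f x * theta h x - theta f x * h x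
    = wf (tau x) ^ 2 / G1 (tau x) * Y (tau x) ^ 2)).
{ assert (dw := pull wf _ Dw). assert (d2 := pull tau2 _ D2). assert (d3 := pull tau3 _ D3).
  assert (d1 := pull (fun s => s) (fun _ => RtoC 1) (fun s _ => is_Cderive_id s)).
  set (wt := fun x => wf (tau x)) in *. set (t2 := fun x => tau2 (tau x)) in *.
  set (t3 := fun x => tau3 (tau x)) in *.
  change (fun x => tau x) with tau in d1. cbv beta in *.
  assert (e0 := fun x => is_theta_unique Z HZ0 w0 _ x dw).
  eassert (dw1 : is_theta Z w1 _) by (change w1
    with (fun x => tau x * wt x); is_theta_auto h_Z HZ0).
  eassert (dw3 : is_theta Z w3 _) by (change w3
    with (fun x => t3 x * wt x); is_theta_auto h_Z HZ0).
  eassert (dw4 : is_theta Z w4 _) by (change w4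
    with (fun x => (tau x * t3 x - t2 x ^ 2) * wt x); is_theta_auto h_Z HZ0).
  assert (e1 := fun x => is_theta_unique Z HZ0 w1 _ x dw1).
  assert (e3 := fun x => is_theta_unique Z HZ0 w3 _ x dw3).
  assert (e4 := fun x => is_theta_unique Z HZ0 w4 _ x dw4). cbv beta in e0, e1, e3, e4.
  assert (Ew0 : forall x, w0 x = wf (tau x)) by reflexivity.
  assert (one0 := RtoC_neq_0 1 R1_neq_R0).
  destruct Hin as [E|[E|[E|[E|[]]]]]; injection E as <- <-.
  - exists (fun _ => RtoC 1), (fun _ => RtoC 0), (fun _ => RtoC 0), (RtoC 0).
    split; [|split; [|split; [|split]]].
    + intros s _. apply (is_Cderive_eq _ _ 0); [apply is_Cderive_const|ring].
    + intros s _. apply is_Cderive_const.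
    + intros s _. apply (is_Cderive_eq _ _ 0); [apply is_Cderive_const|ring].
    + intros s _ [E' _]. exact (one0 E').
    + intros x Zx. rewrite (e0 x Zx), (e1 x Zx). specialize (a0 x Zx). unfold w1, wt, t2, t3.
      rewrite !Ew0. field; neq_0.
  - exists tf, (fun _ => RtoC 1), (fun _ => RtoC 0), (RtoC 0).
    split; [|split; [|split; [|split]]].
    + intros s Vs. apply (is_Cderive_eq _ _ (v s)); [auto|ring].
    + intros s _. apply is_Cderive_const.
    + intros s _. apply (is_Cderive_eq _ _ 0); [apply is_Cderive_const|ring].
    + intros s _ [_ [E' _]]. exact (one0 E').
    + intros x Zx. rewrite (e0 x Zx), (e3 x Zx). specialize (a0 x Zx). unfold w3, wt, t2, t3.
      rewrite !Ew0. field; neq_0.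
  - exists (fun s => s * tf s + tau2 s), (fun s => s), (fun _ => RtoC 1), (RtoC 0).
    split; [|split; [|split; [|split]]].
    + intros s Vs. apply (is_Cderive_eq _ _ (1 * tf s + s * v s + - tf s)); [|ring].
      apply (is_Cderive_plus (fun s => s * tf s)); [apply (is_Cderive_mult (fun s => s));
        [apply is_Cderive_id|auto]|auto].
    + intros s _. apply is_Cderive_id.
    + intros s _. apply (is_Cderive_eq _ _ 0); [apply is_Cderive_const|ring].
    + intros s _ [_ [_ [E' _]]]. exact (one0 E').
    + intros x Zx. rewrite (e1 x Zx), (e4 x Zx). specialize (a0 x Zx).
      unfold w1, w4, wt, t2, t3. rewrite !Ew0. field; neq_0.
  (* Here [q = tau2] has derivative [-t], so [r' = -v] and [kappa = -1]. In [Y'] the terms with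
     [t^2] cancel between [tau3'] and [tau2' t]. *)
  - exists (fun s => tau3 s + tau2 s * tf s), tau2, (fun s => - tf s), (- (1)).
    split; [|split; [|split; [|split]]].
    + intros s Vs.
      apply (is_Cderive_eq _ _ (tf s * tf s + (- tf s * tf s + tau2 s * v s))); [|ring].
      apply (is_Cderive_plus tau3 (fun s => tau2 s * tf s)); [auto|apply is_Cderive_mult; auto].
    + exact D2.
    + intros s Vs. apply (is_Cderive_eq _ _ (0 * tf s + - (1) * v s)); [|ring].
      apply (is_Cderive_ext_on V HV (fun s => - (1) * tf s)); [intros; ring|exact Vs|].
      apply (is_Cderive_mult (fun _ => - (1)) tf); [apply is_Cderive_const|auto].
    + intros s _ [_ [_ [_ E']]]. apply one0. replace (RtoC 1) with (- - (1)) by ring.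
      rewrite E'. ring.
    + intros x Zx. rewrite (e3 x Zx), (e4 x Zx). specialize (a0 x Zx).
      unfold w3, w4, wt, t2, t3. rewrite !Ew0. field; neq_0. }
destruct main as [Y [q [r [kappa [DY [Dq [Dr [NV W]]]]]]]].
refine (ode_pullback V Z zf tau HV h_Z HZ0 _ _ _ stau tauV ztau wf v Y q r P d kappa _ _ _ _ DY
  Dq Dr NV HP _ _).
- apply (smooth_sub V0); assumption.
- intros s Vs. apply (HVn s Vs).
- intros s Vs. apply (HVn s Vs).
- apply (smooth_sub V0); assumption.
- intros s Vs. apply (HVn s Vs).
- apply (smooth_sub V0); assumption.
- intros s Vs. apply (HVn s Vs).
- apply smooth_analytic; assumption.
- intros x Zx. rewrite (Ed x Zx). exact (W x Zx).
Qed.
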